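(* On a post-critically finite self-similar set $X$ with regular harmonic structure there is $\kappa_7>0$ such that for all $t>0$ and $x,y\in X$ \[ |p_t(x,y)|\lesssim t^{-S/(S+1)}\exp\bigl(-\kappa_7\,d_{k(t^{-1})}(x,y)\bigr). \]
   Context: Setting. $X$ is a post-critically finite self-similar fractal in the sense of Kigami: a compact metrizable space with continuous injections $F_1,\dots,F_J:X\to X$ and a compatible continuous surjection $\{1,\dots,J\}^{\mathbb N}\to X$. $W_*$ is the set of finite words over $\{1,\dots,J\}$ (including the empty word), $\Sigma$ the set of infinite words, and $F_w=F_{w_1}\circ\cdots\circ F_{w_m}$ for $w=w_1\cdots w_m$. $V_0\subset X$ is the finite post-critical set (the boundary of $X$), so $F_j(X)\cap F_k(X)\subset F_j(V_0)\cap F_k(V_0)$ for $j\ne k$; $X\setminus V_0$ is assumed connected. There is a regular self-similar harmonic structure giving an irreducible self-similar Dirichlet form $E$ with domain $\mathrm{dom}(E)\subset C(X)$ and scalings $0<r_j<1$, $E(u)=\sum_j r_j^{-1}E(u\circ F_j)$; $E(u,v)$ denotes the bilinear form. $S$ is the unique number with $\sum_j r_j^S=1$ and $\mu$ is the self-similar probability measure $\mu(A)=\sum_j\mu_j\mu(F_j^{-1}(A))$ with $\mu_j=r_j^S$. Write $r_w=r_{w_1}\cdots r_{w_m}$. Laplacian: $u\in\mathrm{dom}(\Delta)$ with $\Delta u=f$ continuous if $E(u,v)=-\int fv\,d\mu$ for all $v\in\mathrm{dom}(E)$ vanishing on $V_0$. Let $\{\phi_j\}$ be an orthonormal basis of $L^2(\mu)$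 of Dirichlet eigenfunctions (vanishing on $V_0$), $\Delta\phi_j=-\lambda_j\phi_j$, eigenvalues repeated by multiplicity. The heat kernel is $p_t(x,y)=\sum_je^{-\lambda_jt}\phi_j(x)\phi_j(y)$, $t>0$. For $p\in V_0$ and $\lambda>0$, $\eta_p^{(\lambda)}$ is the function with $(\lambda I-\Delta)\eta_p^{(\lambda)}=0$ on $X\setminus V_0$ and $\eta_p^{(\lambda)}(q)=\delta_{pq}$ for $q\in V_0$. Partitions and distances: $\Theta_k=\{\theta_1\cdots\theta_m: r_{\theta_1}\cdots r_{\theta_m}\le e^{-k}<r_{\theta_1}\cdots r_{\theta_{m-1}}\}$ ($\Theta_0$ consists of the empty word); $V(\Theta')=\bigcup_{\theta\in\Theta'}F_\theta(V_0)$ for $\Theta'\subset\Theta_k$. $\Gamma_k$ is the graph with vertices $V(\Theta_k)$ and an edge between $x,y$ when $x,y\in F_\theta(V_0)$ for some $\theta\in\Theta_k$; $d_k$ is its graph distance. If $x$ is interior to a cell $F_\theta(X)$, $\theta\in\Theta_k$, then $d_k(x,y)$ is the minimum over $z\in F_\theta(V_0)$ of $d_k(z,y)$, and similarly in the second variable. Definition of $k(\lambda)$: fix a constant $C>0$, depending only on the fractal and harmonic structure, such that for all $\lambda>0$, $k\ge0$, $p\in V_0$, $\Theta'\subset\Theta_k$ and $Y=\bigcup_{\theta\in\Theta'}F_\theta(X)$ one has $\sum_{y\in V(\Theta')\setminus\partial Y}\eta_p^{(\lambda)}(y)\le C\bigl(e^{k(S+1)}\lambda^{-1}+e^k\lambda^{-1/(S+1)}\bigr)\sum_{z\in\partial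 Y}\eta_p^{(\lambda)}(z)$, where $\partial Y$ is the topological boundary of $Y$ in $X$ together with $Y\cap V_0$ (such $C$ exists). Then $k(\lambda)$ is the larger of $0$ and the greatest integer $\le\frac1{S+1}\log\lambda-\log C-2$. $a\lesssim b$ means $a\le c'b$ with a constant $c'>0$ depending only on the fractal, harmonic structure or measure. *)

(* Defs.v *)
From HB Require Import structures.
From mathcomp Require Import all_boot all_order all_algebra.
From mathcomp Require Import all_classical all_reals all_analysis.

Set Implicit Arguments.
Unset Strict Implicit.
Unset Printing Implicit Defensive.

Import Order.TTheory GRing.Theory Num.Theory.
Import numFieldNormedType.Exports.

Local Open Scope classical_set_scope.
Local Open Scope ring_scope.

(* Pointedness is only needed by the library to equip the type with its Borel
   sigma-algebra; self-similar sets are nonempty. *)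
#[short(type="pmetricType")]
HB.structure Definition PMetric (K : numDomainType) :=
  { M of Metric K M & Pointed M }.

Definition borel (R : realType) (X : pmetricType R) :=
  g_sigma_algebraType (@open X).

Notation shift_space J :=
  (prod_topology (fun _ : nat => discrete_topology 'I_J)).

Definition seq_cons (J : nat) (j : 'I_J) (w : shift_space J) : shift_space J :=
  fun n => if n is m.+1 then w m else j.

Section SelfSimilar.
Context (R : realType) (X : pmetricType R) (J : nat).
Variables (F : 'I_J -> X -> X) (pi : shift_space J -> X).

Record self_similar_set : Prop := {
  ss_compact : compact [set: X];
  ss_cont : forall j, continuous (F j);
  ss_inj : forall j, injective (F j);
  ss_pi_cont : continuous pi;
  ss_pi_surj : forall x, exists w, pi w = x;
  ss_pi_compat : forall j w, F j (pi w) = pi (seq_cons j w) }.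

Definition Fword (w : seq 'I_J) : X -> X := foldr (fun j f => F j \o f) id w.

Definition critical_set : set (shift_space J) :=
  [set w | exists i j, i != j /\ (range (F i) `&` range (F j)) (pi w)].

(* The images of the critical set under the iterates, of order at least one,
   of the shift map. *)
Definition post_critical_set : set (shift_space J) :=
  \bigcup_n [set (fun m => w (n.+1 + m)%N) | w in critical_set].

Definition post_critically_finite := finite_set post_critical_set.

Definition V0 : set X := pi @` post_critical_set.

End SelfSimilar.

Section HarmonicStructure.
Context (R : realType) (X : pmetricType R) (J : nat).
Variables (F : 'I_J -> X -> X) (B : set X) (c : X -> X -> R) (r : 'I_J -> R).

Definition rword (w : seq 'I_J) : R := \prod_(j <- w) r j.

(* The form on functions on the boundary B given by the conductances c. *)
Definition energy0 (u v : X -> R) : R :=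
  2^-1 * \sum_(p \in B) \sum_(q \in B) c p q * (u p - u q) * (v p - v q).

Definition energyn (m : nat) (u v : X -> R) : R :=
  \sum_(w : m.-tuple 'I_J)
    (rword w)^-1 * energy0 (u \o Fword F w) (v \o Fword F w).

(* The last field says that the trace on B of the level one form is the level
   zero form: energy0 u u is the minimum of energyn 1 v v over the extensions v
   of the restriction of u to B. *)
Record regular_harmonic_structure : Prop := {
  hs_regular : forall j, 0 < r j < 1;
  hs_sym : forall p q, B p -> B q -> c p q = c q p;
  hs_ge0 : forall p q, B p -> B q -> 0 <= c p q;
  hs_irreducible : forall u, energy0 u u = 0 ->
    forall p q, B p -> B q -> u p = u q;
  hs_renorm : forall u,
    (forall v, (forall p, B p -> v p = u p) ->
       energy0 u u <= energyn 1 v v) /\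
    (exists2 v, (forall p, B p -> v p = u p) &
       energyn 1 v v = energy0 u u) }.

Definition dom_energy : set (X -> R) :=
  [set u : X -> R | continuous u /\ cvg (energyn m u u @[m --> \oo])].

Definition energy (u v : X -> R) : R := lim (energyn m u v @[m --> \oo]).

Definition self_similar_measure (S : R) (mu : probability (borel X) R) :=
  forall A : set (borel X), measurable A ->
    (mu A = \sum_(j < J) (r j `^ S)%:E * mu (F j @^-1` A))%E.

Variable mu : probability (borel X) R.

Definition is_laplacian (u f : X -> R) : Prop :=
  [/\ dom_energy u, continuous f &
      forall v, dom_energy v -> (forall p, B p -> v p = 0) ->
        energy u v = - \int[mu]_x (f x * v x)].

Definition orthonormal_basis (phi : nat -> X -> R) : Prop :=
  [/\ forall i, (phi i : borel X -> R) \in Lfun mu 2%:E,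
      forall i j, \int[mu]_x (phi i x * phi j x) = (i == j)%:R &
      forall f : borel X -> R, f \in Lfun mu 2%:E ->
        (\int[mu]_x (f x - \sum_(i < n)
            (\int[mu]_y (f y * phi i y)) * phi i x) ^+ 2) @[n --> \oo] --> 0].

Definition dirichlet_eigenbasis (phi : nat -> X -> R) (lam : nat -> R) : Prop :=
  [/\ orthonormal_basis phi,
      forall j p, B p -> phi j p = 0 &
      forall j, is_laplacian (phi j) (fun x => - lam j * phi j x)].

Definition is_eta (lam : R) (p : X) (eta : X -> R) : Prop :=
  is_laplacian eta (fun x => lam * eta x) /\
  (forall q, B q -> eta q = (p == q)%:R).

Definition Theta (k : nat) : set (seq 'I_J) :=
  [set w | rword w <= expR (- k%:R) /\
           forall v j, w = rcons v j -> expR (- k%:R) < rword v].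

Definition vertices (T : set (seq 'I_J)) : set X :=
  \bigcup_(w in T) (Fword F w @` B).

Definition cells (T : set (seq 'I_J)) : set X :=
  \bigcup_(w in T) range (Fword F w).

Definition cell_boundary (Y : set X) : set X :=
  (closure Y `\` interior Y) `|` (Y `&` B).

Definition edge (k : nat) (x y : X) : Prop :=
  exists2 w, Theta k w & (Fword F w @` B) x /\ (Fword F w @` B) y.

Definition walk (k n : nat) (x y : X) : Prop :=
  exists p : nat -> X,
    [/\ p 0%N = x, p n = y & forall i, (i < n)%N -> edge k (p i) (p i.+1)].

(* The vertices from which distances to x are measured: x itself if x is a
   vertex of the graph, otherwise the boundary vertices of the cell of level k
   having x in its interior. *)
Definition anchors (k : nat) (x : X) : set X :=
  [set z | (vertices (Theta k) x /\ z = x) \/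
           (~ vertices (Theta k) x /\
            exists2 w, Theta k w & range (Fword F w) x /\ (Fword F w @` B) z)].

(* The infimum is a minimum, the graph being connected. *)
Definition cell_dist (k : nat) (x y : X) : R :=
  inf [set n%:R | n in
    [set n : nat | exists a b,
       [/\ anchors k x a, anchors k y b & walk k n a b]]].

Definition admissible_constant (S C : R) : Prop :=
  forall (lam : R) (k : nat) (p : X) (T : set (seq 'I_J)) (eta : X -> R),
    0 < lam -> B p -> T `<=` Theta k -> is_eta lam p eta ->
    \sum_(y \in vertices T `\` cell_boundary (cells T)) eta y <=
    C * (expR (k%:R * (S + 1)) * lam^-1 + expR k%:R * lam `^ (- (S + 1)^-1)) *
    \sum_(z \in cell_boundary (cells T)) eta z.

End HarmonicStructure.

Definition heat_kernel (R : realType) (X : Type) (phi : nat -> X -> R)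
    (lam : nat -> R) (t : R) (x y : X) : R :=
  lim (series (fun j => expR (- lam j * t) * phi j x * phi j y) @ \oo).

Definition klevel (R : realType) (S C lam : R) : nat :=
  absz (Num.max 0 (Num.floor ((S + 1)^-1 * ln lam - ln C - 2))).

(* Main.v *)
Require Import Defs.
From HB Require Import structures.
From mathcomp Require Import all_boot all_order all_algebra.
From mathcomp Require Import all_classical all_reals all_analysis.
From mathcomp Require Import measurable_realfun finmap ring lra.

Set Implicit Arguments.
Unset Strict Implicit.
Unset Printing Implicit Defensive.

Import Order.TTheory GRing.Theory Num.Theory.
Import numFieldNormedType.Exports.

Local Open Scope classical_set_scope.
Local Open Scope ring_scope.

(** The proof is Davies' method of exponential weights, carried out with finite
sums over cells.

Let [k] be the level with [e^{-k}] of the order of [t^{1/(S+1)}], let [D] be the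
distance from [x] to [y] at this level, and let [a] be the distance to [y], cut
off at [D]. The lemma [spline] replaces [a] by a function [g] of finite energy
with the same values on the vertices of level [k] and harmonic inside the cells of
this level: adjacent vertices have values that differ by at most one, so that on
each cell, rescaled to [X], the energy of [g] is at most a constant. The energy
controls the oscillation, [(u x - u y)^2 <= K E(u, u)] (lemma [oscillation]); this
comes from irreducibility and from the linkage of the first-level cells, by a
geometric series along the cells that shrink to a point.

For a small constant [h], the form and the weight [e^{hg}] then satisfy
[E(u, e^{2hg} u) >= - Lam || e^{hg} u ||^2] with [Lam] of the order of [1/t] (lemma
[davies]). For two points the difference between the product of increments of
[u] and [e^{2hg} u] and the squared increment of [v = e^{hg} u] is at most
[3 h^2 (g x - g y)^2 sup v^2]; on a cell of level [k] the supremum is controlled by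
the energy and the mean square of [v], so for small [h] the energy absorbs its
part and the mean square remains. Hence along the heat flow the weighted
mean square grows at most by the constant factor [e^{2 Lam t}] up to the time [t]
(lemma [weighted_evolution]), and heat that starts near [y], where [g] is close to
[0], reaches the neighbourhood of [x], where [g] is close to [D], only with a
factor [e^{-hD}] in the mean.

To pass from means to values, the kernel is averaged over cells of level [k + m]
around [x] and [y] (lemma [partial_kernel_cells]). The error is the oscillation of
the kernel, which the energy of [p_t(., y)] and the on-diagonal bound
[p_t(y, y) <= C1 t^{-S/(S+1)}] (lemma [diagonal_bound]) make at most
[e^{-m/2} t^{-S/(S+1)}] up to a constant; the price is the reciprocal of the measure
of a cell, which contains the factor [e^{Sm}]. With [m] of the order of
[h D / (S + 1)] both contributions decay exponentially in [D].

If [k = 0], as for all large times, distances are at most one and the on-diagonal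
bound is enough. *)

(** * Discrete energies as sums over pairs *)

Section PairSums.
Context (R : realType) (X : pmetricType R) (J : nat).
Variables (F : 'I_J -> X -> X) (B : set X) (c : X -> X -> R) (r : 'I_J -> R).
Hypotheses (Bfin : finite_set B) (hharm : regular_harmonic_structure F B c r).

Local Notation E0 := (energy0 B c).
Local Notation En := (energyn F B c r).
Local Notation E := (energy F B c r).
Local Notation dom := (dom_energy F B c r).
Local Notation Fw := (Fword F).
Local Notation rw := (rword r).

Lemma ratio_gt0 j : 0 < r j.
Proof. by have /andP[] := hs_regular hharm j. Qed.

Lemma ratio_lt1 j : r j < 1.
Proof. by have /andP[] := hs_regular hharm j. Qed.

Lemma rword_nil : rw [::] = 1.
Proof. by rewrite /rword big_nil. Qed.

Lemma rword_cons j w : rw (j :: w) = r j * rw w.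
Proof. by rewrite /rword big_cons. Qed.

Lemma rword_cat v w : rw (v ++ w) = rw v * rw w.
Proof. by rewrite /rword big_cat. Qed.

Lemma rword_rcons w j : rw (rcons w j) = rw w * r j.
Proof. by rewrite -cats1 rword_cat rword_cons rword_nil mulr1. Qed.

Lemma rword_gt0 w : 0 < rw w.
Proof. by apply: prodr_gt0 => j _; exact: ratio_gt0. Qed.

Lemma rword_le1 w : rw w <= 1.
Proof.
elim: w => [|j w IH]; first by rewrite rword_nil.
by rewrite rword_cons mulr_ile1// ?ltW ?ratio_gt0 ?ratio_lt1 ?rword_gt0// ltW.
Qed.

Lemma Fword_cat v w x : Fw (v ++ w) x = Fw v (Fw w x).
Proof. by elim: v => //= j v ->. Qed.

Lemma Fword_rcons w j x : Fw (rcons w j) x = Fw w (F j x).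
Proof. by rewrite -cats1 Fword_cat. Qed.

(** Every quadratic expression below is a sum of this kind, so that an
inequality between energies follows from one between the values of functions
at two points. *)
Definition pair_sum (m : nat) (Phi : X -> X -> R) : R :=
  \sum_(w : m.-tuple 'I_J) (rw w)^-1 *
    (2^-1 * \sum_(p <- fset_set B) \sum_(q <- fset_set B)
       c p q * Phi (Fw w p) (Fw w q)).

Lemma fset_setB p : (p \in fset_set B) = (p \in B).
Proof. by rewrite in_fset_set. Qed.

Lemma conductance_ge0 p q :
  p \in fset_set B -> q \in fset_set B -> 0 <= c p q.
Proof. rewrite !fset_setB => /set_mem Bp /set_mem Bq; exact: (hs_ge0 hharm). Qed.

Lemma energy0E u v : E0 u v =
  2^-1 * \sum_(p <- fset_set B) \sum_(q <- fset_set B)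
       c p q * ((u p - u q) * (v p - v q)).
Proof.
rewrite /energy0 fsbig_finite//; congr (_ * _).
apply: eq_bigr => p _; rewrite fsbig_finite//.
by apply: eq_bigr => q _; rewrite mulrA.
Qed.

Lemma energynE m u v :
  En m u v = pair_sum m (fun x y => (u x - u y) * (v x - v y)).
Proof. by rewrite /energyn; apply: eq_bigr => w _; rewrite energy0E. Qed.

Lemma pair_sum_le m Phi Psi : (forall x y, Phi x y <= Psi x y) ->
  pair_sum m Phi <= pair_sum m Psi.
Proof.
move=> le; apply: ler_sum => w _.
rewrite ler_pM2l ?invr_gt0 ?rword_gt0// ler_pM2l ?invr_gt0//.
rewrite big_seq [leRHS]big_seq; apply: ler_sum => p Bp.
rewrite big_seq [leRHS]big_seq; apply: ler_sum => q Bq.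
by apply: ler_wpM2l; [exact: conductance_ge0|exact: le].
Qed.

Lemma pair_sum_lin m a b Phi Psi :
  pair_sum m (fun x y => a * Phi x y + b * Psi x y) =
  a * pair_sum m Phi + b * pair_sum m Psi.
Proof.
rewrite /pair_sum !mulr_sumr -big_split/=; apply: eq_bigr => w _.
rewrite [a * _]mulrCA [b * _]mulrCA -mulrDr; congr (_ * _).
rewrite [a * _]mulrCA [b * _]mulrCA -mulrDr; congr (_ * _).
rewrite !mulr_sumr -big_split/=; apply: eq_bigr => p _.
rewrite !mulr_sumr -big_split/=; apply: eq_bigr => q _.
by rewrite mulrDr ![c p q * (_ * _)]mulrCA.
Qed.

Lemma eq_pair_sum m Phi Psi : (forall x y, Phi x y = Psi x y) ->
  pair_sum m Phi = pair_sum m Psi.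
Proof.
move=> eqP; congr pair_sum; apply/funext => x; apply/funext => y; exact: eqP.
Qed.

Lemma pair_sum_ge0 m Phi : (forall x y, 0 <= Phi x y) -> 0 <= pair_sum m Phi.
Proof.
move=> ge0; have := pair_sum_lin m 0 0 Phi Phi; rewrite !mul0r addr0 => <-.
by apply: pair_sum_le => x y; rewrite !mul0r addr0.
Qed.

Lemma big_tupleS (V : nmodType) m (G : seq 'I_J -> V) :
  \sum_(w : m.+1.-tuple 'I_J) G w =
  \sum_j \sum_(w : m.-tuple 'I_J) G (j :: w).
Proof.
rewrite pair_bigA /=.
rewrite (reindex (fun p : 'I_J * m.-tuple 'I_J => [tuple of p.1 :: p.2])) //=.
exists (fun t : m.+1.-tuple 'I_J => (thead t, [tuple of behead t])).
  by move=> [j t] _ /=; congr (_, _); apply/val_inj.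
by move=> t _ /=; rewrite -tuple_eta.
Qed.

Lemma pair_sumS m Phi : pair_sum m.+1 Phi =
  \sum_j (r j)^-1 * pair_sum m (fun x y => Phi (F j x) (F j y)).
Proof.
rewrite /pair_sum (big_tupleS m (fun w => (rw w)^-1 * (2^-1 *
  \sum_(p <- fset_set B) \sum_(q <- fset_set B) c p q * Phi (Fw w p) (Fw w q)))).
apply: eq_bigr => j _; rewrite mulr_sumr; apply: eq_bigr => w _.
by rewrite rword_cons invfM -mulrA.
Qed.

Lemma pair_sum0 Phi : pair_sum 0 Phi =
  2^-1 * \sum_(p <- fset_set B) \sum_(q <- fset_set B) c p q * Phi p q.
Proof.
rewrite /pair_sum (big_pred1 [tuple])/= ?rword_nil ?invr1 ?mul1r// => w.
by apply/esym/eqP; exact: tuple0.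
Qed.

Lemma energyn0 u v : En 0 u v = E0 u v.
Proof. by rewrite energynE pair_sum0 energy0E. Qed.

Lemma energynS m u v :
  En m.+1 u v = \sum_j (r j)^-1 * En m (u \o F j) (v \o F j).
Proof.
by rewrite energynE pair_sumS; apply: eq_bigr => j _; rewrite energynE.
Qed.

Lemma energynC m u v : En m u v = En m v u.
Proof. by rewrite !energynE; apply: eq_pair_sum => x y; rewrite mulrC. Qed.

Lemma energyn_ge0 m u : 0 <= En m u u.
Proof.
by rewrite energynE; apply: pair_sum_ge0 => x y; rewrite -expr2 sqr_ge0.
Qed.

Lemma energyn_homo u : {homo (fun m => En m u u) : m n / (m <= n)%N >-> m <= n}.
Proof.
apply/nondecreasing_seqP => m; elim: m u => [|m IH] u.
  by rewrite energyn0; apply: (hs_renorm hharm u).1.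
rewrite energynS [leRHS]energynS; apply: ler_sum => j _.
by rewrite ler_pM2l ?invr_gt0 ?ratio_gt0.
Qed.

Lemma domP u : dom u <-> continuous u /\ exists M, forall m, En m u u <= M.
Proof.
split=> -[cu]; last first.
  move=> [M bM]; split=> //; apply: nondecreasing_is_cvgn.
    exact: energyn_homo.
  by exists M => _ [m _ <-].
move=> cvgu; split=> //; exists (E u u) => m.
exact: (nondecreasing_cvgn_le (@energyn_homo u) cvgu m).
Qed.

Lemma dom_continuous u : dom u -> continuous u.
Proof. by case. Qed.

Lemma energyn_le m u : dom u -> En m u u <= E u u.
Proof.
by move=> [_ cvgu]; exact: (nondecreasing_cvgn_le (@energyn_homo u) cvgu m).
Qed.

Lemma energy_ge0 u : dom u -> 0 <= E u u.
Proof. by move=> du; apply: le_trans (energyn_le 0 du); exact: energyn_ge0. Qed.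

Lemma dom_of_increments (f g u : X -> R) (K L : R) : continuous f ->
  dom g -> dom u -> 0 <= K -> 0 <= L ->
  (forall x y, (f x - f y) ^+ 2 <= K * (g x - g y) ^+ 2 + L * (u x - u y) ^+ 2) ->
  dom f.
Proof.
move=> cf dg du K0 L0 le; apply/domP; split=> //.
exists (K * E g g + L * E u u) => m.
apply: (@le_trans _ _ (K * En m g g + L * En m u u)).
  rewrite !energynE -pair_sum_lin; apply: pair_sum_le => x y.
  by rewrite -!expr2.
by apply: lerD; apply: ler_wpM2l => //; exact: energyn_le.
Qed.

Lemma dom_cst (a : R) : dom (fun=> a).
Proof.
apply/domP; split; first by move=> x; exact: cvg_cst.
exists 0 => m; rewrite energynE.
have -> : 0 = pair_sum m (fun x y => 0 * 0 + 0 * 0) by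
  rewrite (pair_sum_lin m 0 0 (fun _ _ => 0) (fun _ _ => 0)) !mul0r addr0.
by apply: pair_sum_le => x y; rewrite subrr !mul0r addr0.
Qed.

Lemma sqr_comb_le (a b s t : R) :
  (a * s + b * t) ^+ 2 <= (2 * a ^+ 2) * s ^+ 2 + (2 * b ^+ 2) * t ^+ 2.
Proof. by have := sqr_ge0 (a * s - b * t); nra. Qed.

Lemma dom_lin (a b : R) u v : dom u -> dom v ->
  dom (fun x => a * u x + b * v x).
Proof.
move=> du dv; apply: (@dom_of_increments _ u v (2 * a ^+ 2) (2 * b ^+ 2)) => //.
- by move=> x; apply: cvgD; apply: cvgM;
    [exact: cvg_cst|exact: (dom_continuous du)|exact: cvg_cst|
     exact: (dom_continuous dv)].
- by rewrite mulr_ge0 ?sqr_ge0.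
- by rewrite mulr_ge0 ?sqr_ge0.
- move=> x y; apply: le_trans _ (sqr_comb_le _ _ _ _).
  by rewrite le_eqVlt; apply/orP; left; apply/eqP; congr (_ ^+ 2); ring.
Qed.

Lemma dom_sum (I : Type) (s : seq I) (a : I -> R) (u : I -> X -> R) :
  (forall i, dom (u i)) -> dom (fun x => \sum_(i <- s) a i * u i x).
Proof.
move=> du; elim: s => [|i s IH].
  by under eq_fun do rewrite big_nil; exact: dom_cst.
under eq_fun do rewrite big_cons.
by have := dom_lin (a i) 1 (du i) IH; under eq_fun do rewrite mul1r.
Qed.

Lemma energyn_polar m u v : En m u v =
  4^-1 * En m (fun x => 1 * u x + 1 * v x) (fun x => 1 * u x + 1 * v x) +
  - 4^-1 * En m (fun x => 1 * u x + -1 * v x) (fun x => 1 * u x + -1 * v x).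
Proof.
rewrite !energynE -pair_sum_lin; by apply: eq_pair_sum => x y; field.
Qed.

Lemma energyn_cvg u v : dom u -> dom v -> En m u v @[m --> \oo] --> E u v.
Proof.
move=> du dv.
suff cvgE : cvg (En m u v @[m --> \oo]) by [].
under eq_fun do rewrite energyn_polar.
have [_ cp] := dom_lin 1 1 du dv; have [_ cm] := dom_lin 1 (-1) du dv.
apply: is_cvgD; (apply: is_cvgM; first exact: is_cvg_cst) => //.
Qed.

Lemma energyn_linl m a b u v w :
  En m (fun x => a * u x + b * v x) w = a * En m u w + b * En m v w.
Proof.
by rewrite !energynE -pair_sum_lin; apply: eq_pair_sum => x y; ring.
Qed.

Lemma energy_linl a b u v w : dom u -> dom v -> dom w ->
  E (fun x => a * u x + b * v x) w = a * E u w + b * E v w.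
Proof.
move=> du dv dw; rewrite {1}/energy; under eq_fun do rewrite energyn_linl.
apply: cvg_lim => //.
by apply: cvgD; apply: cvgM; [exact: cvg_cst|exact: energyn_cvg|
   exact: cvg_cst|exact: energyn_cvg].
Qed.

Lemma energy_suml (I : Type) (s : seq I) (a : I -> R) (u : I -> X -> R) w :
  (forall i, dom (u i)) -> dom w ->
  E (fun x => \sum_(i <- s) a i * u i x) w = \sum_(i <- s) a i * E (u i) w.
Proof.
move=> du dw; elim: s => [|i s IH].
  rewrite big_nil; under eq_fun do rewrite big_nil.
  have := energy_linl 0 0 (dom_cst 0) (dom_cst 0) dw.
  by under eq_fun do rewrite mul0r addr0; rewrite !mul0r addr0.
rewrite big_cons -IH; under eq_fun do rewrite big_cons.
have := energy_linl (a i) 1 (du i) (dom_sum s a du) dw.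
by under eq_fun do rewrite mul1r; rewrite mul1r.
Qed.

(** Conductances being nonnegative, an inequality that holds for every pair of
points survives summation over pairs and the limit. All product and chain rules
for energies are obtained in this way, without any calculus. *)
Lemma energy_le_of_increments (a b d : R) (f g u v : X -> R) :
  dom f -> dom g -> dom u -> dom v ->
  (forall x y, a * ((u x - u y) * (u x - u y)) + b * ((g x - g y) * (g x - g y))
     <= d * ((f x - f y) * (v x - v y))) ->
  a * E u u + b * E g g <= d * E f v.
Proof.
move=> df dg du dv le.
have cl : a * En m u u + b * En m g g @[m --> \oo] --> a * E u u + b * E g g.
  by apply: cvgD; apply: cvgM; [exact: cvg_cst|exact: energyn_cvg|
     exact: cvg_cst|exact: energyn_cvg].
have cr : d * En m f v @[m --> \oo] --> d * E f v.
  by apply: cvgM; [exact: cvg_cst|exact: energyn_cvg].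
rewrite -(cvg_lim _ cl)// -(cvg_lim _ cr)//.
apply: ler_lim; [exact: cvgP cl|exact: cvgP cr|apply: nearW => m].
rewrite !energynE -pair_sum_lin -[leRHS]addr0.
rewrite -[X in _ + X](mul0r (pair_sum m (fun _ _ => 0))) -pair_sum_lin.
by apply: pair_sum_le => x y; rewrite mul0r addr0.
Qed.

Lemma dom_compF j u : (forall i, continuous (F i)) -> dom u -> dom (u \o F j).
Proof.
move=> cF du; apply/domP; split.
  by move=> x; apply: continuous_comp; [exact: cF|exact: (dom_continuous du)].
exists (r j * E u u) => m; rewrite -ler_pdivrMl ?ratio_gt0//.
apply: le_trans (energyn_le m.+1 du); rewrite energynS (bigD1 j)//= lerDl.
by apply: sumr_ge0 => i _; rewrite mulr_ge0 ?energyn_ge0 ?invr_ge0 ?ltW ?ratio_gt0.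
Qed.

Lemma dom_compFw w u : (forall i, continuous (F i)) -> dom u -> dom (u \o Fw w).
Proof.
move=> cF; elim: w u => [//|j w IH] u du.
exact: (IH _ (dom_compF j cF du)).
Qed.

Lemma dom_of_compF u : continuous u -> (forall j, dom (u \o F j)) -> dom u.
Proof.
move=> cu du; apply/domP; split=> //.
exists (En 0 u u + \sum_j (r j)^-1 * E (u \o F j) (u \o F j)) => -[|m].
  rewrite lerDl sumr_ge0// => j _.
  by rewrite mulr_ge0 ?energy_ge0 ?invr_ge0 ?ltW ?ratio_gt0.
rewrite energynS -[leLHS]add0r; apply: lerD; first exact: energyn_ge0.
apply: ler_sum => j _; rewrite ler_pM2l ?invr_gt0 ?ratio_gt0//.
exact: energyn_le.
Qed.

Lemma energy_selfsimilar u v : (forall j, dom (u \o F j)) ->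
  (forall j, dom (v \o F j)) ->
  E u v = \sum_j (r j)^-1 * E (u \o F j) (v \o F j).
Proof.
move=> du dv; apply: cvg_lim => //; rewrite -(cvg_shiftS (fun m => En m u v)).
under eq_fun do rewrite /= energynS.
apply: cvg_big => [|j _]; first exact: add_continuous.
by apply: cvgM; [exact: cvg_cst|exact: energyn_cvg].
Qed.

End PairSums.

(** * Cells and words *)

Lemma finite_injective_surjective (T : choiceType) (f : T -> T) :
  finite_set [set: T] -> injective f -> forall y, exists x, f x = y.
Proof.
move=> Tfin finj y; set A := fset_set [set: T].
have AT x : x \in A by rewrite in_fset_set// in_setT.
have /eqP eqA : (f @` A)%fset == A.
  rewrite eqEfcard; apply/andP; split; first by apply/fsubsetP => z _; exact: AT.
  by rewrite card_imfset.
have : y \in (f @` A)%fset by rewrite eqA.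
by move=> /imfsetP[x _ ->]; exists x.
Qed.

Section Cells.
Context (R : realType) (X : pmetricType R) (J : nat).
Variables (F : 'I_J -> X -> X) (pi : shift_space J -> X).
Hypotheses (hX : self_similar_set F pi) (hpcf : post_critically_finite F pi).

Local Notation V0 := (V0 F pi).
Local Notation Fw := (Fword F).

Definition prefix_word (om : shift_space J) n : seq 'I_J := mkseq om n.
Definition shift_word (om : shift_space J) n : shift_space J :=
  fun m => om (n + m)%N.

Lemma size_prefix_word om n : size (prefix_word om n) = n.
Proof. exact: size_mkseq. Qed.

Lemma prefix_wordS om n : prefix_word om n.+1 = rcons (prefix_word om n) (om n).
Proof. by rewrite /prefix_word mkseqS. Qed.

Lemma seq_cons_shift om n :
  seq_cons (om n) (shift_word om n.+1) = shift_word om n.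
Proof.
by apply/funext => -[|m]; rewrite /shift_word/= ?addn0// addnS addSn.
Qed.

Lemma pi_prefix om n : pi om = Fw (prefix_word om n) (pi (shift_word om n)).
Proof.
elim: n => [|n IH]; first by congr pi; apply/funext => m.
by rewrite prefix_wordS Fword_rcons (ss_pi_compat hX) seq_cons_shift.
Qed.

Lemma V0_finite : finite_set V0.
Proof. exact: finite_image. Qed.

(** A code of [F i x] is critical, and its shift, which codes [x], is
post-critical. *)
Lemma cells_meet i j x y : i != j -> F i x = F j y -> V0 x.
Proof.
move=> ij eqF; have [om omx] := ss_pi_surj hX x.
exists om => //; exists 0%N => //; exists (seq_cons i om) => //.
exists i, j; split=> //; rewrite -(ss_pi_compat hX) omx.
by split; [exists x|rewrite eqF; exists y].
Qed.

Lemma V0_pred p : V0 p -> exists j q, V0 q /\ F j q = p.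
Proof.
move=> [om [n _ [ka crit <-]] <-].
pose om' : shift_space J := fun m => ka (n.+1 + m)%N.
exists (om' 0%N), (pi (shift_word om' 1)); split.
  exists (shift_word om' 1) => //; exists n.+1 => //; exists ka => //.
  by apply/funext => m; rewrite /shift_word /om' add1n addnS addSn.
by rewrite (pi_prefix om' 1).
Qed.

Lemma Fword_continuous w : continuous (Fw w).
Proof.
elim: w => [|j w IH] x; first exact: cvg_id.
apply: (@continuous_comp _ _ _ (Fw w) (F j)); first exact: IH.
exact: (ss_cont hX).
Qed.

Lemma cell_closed w : closed (range (Fw w)).
Proof.
apply: compact_closed; first exact: metric_hausdorff.
apply: continuous_compact; last exact: ss_compact hX.
exact/continuous_subspaceT/Fword_continuous.
Qed.

Lemma Fword_inj w : injective (Fw w).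
Proof.
by elim: w => [|j w IH] x y//= /(ss_inj hX)/IH.
Qed.

Lemma cell_cover n x : exists2 w, size w = n & range (Fw w) x.
Proof.
have [om <-] := ss_pi_surj hX x.
exists (prefix_word om n); first exact: size_prefix_word.
by exists (pi (shift_word om n)) => //; rewrite -pi_prefix.
Qed.

(** The cells along an infinite word shrink to the point that it codes. *)
Lemma cells_cvg om x : Fw (prefix_word om n) x @[n --> \oo] --> pi om.
Proof.
have [ka kax] := ss_pi_surj hX x.
pose g n : shift_space J := fun m => if (m < n)%N then om m else ka (m - n)%N.
have gcvg : g @ \oo --> om.
  apply/cvg_sup => N U [V] [[W] oW <-] WfN WU.
  by apply: (filterS WU); rewrite nbhs_simpl /g; exists N.+1 => // i /= ->.
have -> : (fun n => Fw (prefix_word om n) x) = pi \o g.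
  apply/funext => n /=; rewrite (pi_prefix (g n) n) -kax; congr (Fw _ (pi _)).
    by apply/eq_in_map => m; rewrite mem_iota add0n /g => /andP[_ ->].
  by apply/funext => m; rewrite /shift_word /g ltnNge leq_addr/= addKn.
apply: (@cvg_comp _ _ _ g pi _ _ _ gcvg).
exact: (ss_pi_cont hX).
Qed.

Lemma infinite_X : (1 < J)%N -> ~ finite_set [set: X].
Proof.
move=> J1 Xfin; pose j0 := Ordinal (ltnW J1); pose j1 := Ordinal J1.
have surj j x : range (F j) x.
  have [y <-] := finite_injective_surjective Xfin (ss_inj hX (j := j)) x.
  by exists y.
have crit w : critical_set F pi w by exists j0, j1.
pose f (n : nat) : shift_space J := fun m => if m == n then j1 else j0.
have finj : injective f.
  move=> m n /(congr1 (fun g : shift_space J => g m)).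
  by rewrite /f eqxx; case: eqVneq => // _ /(congr1 val).
have := @finite_preimage _ _ _ f (in2W finj) hpcf.
apply: contraPP => _; rewrite (_ : _ @^-1` _ = setT); first exact: infinite_nat.
apply/seteqP; split => // n _; exists 0%N => //.
by exists (seq_cons j0 (f n)) => //; apply/funext.
Qed.

Hypothesis hconn : connected (~` V0).

(** A family of first-level cells disjoint from the others would separate
[X] outside of the boundary: one side would lie in the finite set [V0], while a
cell is infinite. *)
Lemma cells_linked (A : set 'I_J) i j : A i -> ~ A j ->
  exists k l x y, [/\ A k, ~ A l & F k x = F l y].
Proof.
move=> Ai Aj; apply: contrapT => nolink.
pose Y (D : set 'I_J) := \bigcup_(k in D) range (F k).
have Ycl D : closed (Y D).
  apply: closed_bigcup; first exact: finite_finset.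
  by move=> k _; exact: (@cell_closed [:: k]).
have cover x : Y A x \/ Y (~` A) x.
  have [w] := cell_cover 1 x; case: w => [//|k [|//]] _ /= kx.
  by have [Ak|Ak] := pselect (A k); [left|right]; exists k.
have disj x : Y A x -> ~ Y (~` A) x.
  move=> [k Ak [a _ ax]] [l Al [b _ bx]]; apply: nolink.
  by exists k, l, a, b; rewrite ax bx.
have J1 : (1 < J)%N.
  case: J i j A Ai Aj {nolink Y Ycl cover disj} => [[]//|[|//]] i j A Ai Aj.
  by case: Aj; rewrite !ord1 in Ai *.
have small k D : D k -> ~ (Y D `<=` V0).
  move=> Dk YV; apply: infinite_X => //.
  have := finite_preimage (in2W (ss_inj hX (j := k))) V0_finite.
  by apply: sub_finite_set => x _; apply: YV; exists k => //; exists x.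
have [[x [nVx Yx]]|none] := pselect (exists x, ~ V0 x /\ Y A x); last first.
  apply: (small i A Ai) => x Yx; apply: contrapT => nVx.
  by apply: none; exists x.
have : ~` V0 `&` Y A = ~` V0.
  apply: hconn.
  - by exists x.
  - exists (~` Y (~` A)); first by rewrite openC; exact: Ycl.
    apply/seteqP; split => z [nVz Yz]; split=> //; first exact: disj.
    by case: (cover z).
  - by exists (Y A) => //; exact: Ycl.
move=> eqV; apply: (small j (~` A) Aj) => z Yz; apply: contrapT => nVz.
have : (~` V0 `&` Y A) z by rewrite eqV.
by move=> [_ /disj].
Qed.

Lemma V0_nonempty : (1 < J)%N -> V0 !=set0.
Proof.
move=> J1; pose j0 := Ordinal (ltnW J1); pose j1 := Ordinal J1.
have [|k [l [x [y [kj0 lj0 eqF]]]]] := @cells_linked [set j0] j0 j1 erefl.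
  by move=> /(congr1 val).
exists x; apply: (cells_meet _ eqF); apply/eqP => kl; apply: lj0.
by rewrite -kl.
Qed.

End Cells.

(** * Oscillation is controlled by energy *)

Lemma common_bound (R : realType) (T : eqType) (s : seq T)
    (P : T -> R -> Prop) :
  (forall i K L, K <= L -> P i K -> P i L) ->
  (forall i, i \in s -> exists K, P i K) ->
  exists2 K, 0 < K & forall i, i \in s -> P i K.
Proof.
move=> mono; elim: s => [|a s IH] ex; first by exists 1.
have [K K0 PK] : exists2 K, 0 < K & forall i, i \in s -> P i K.
  by apply: IH => i si; apply: ex; rewrite inE si orbT.
have [L PL] := ex a (mem_head a s).
exists (Num.max K L); first by rewrite lt_max K0.
move=> i; rewrite inE => /predU1P[->|si].
  by apply: mono PL; rewrite le_max lexx orbT.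
by apply: mono (PK i si); rewrite le_max lexx.
Qed.

Lemma sqr_chain (R : realType) (x y z K L e : R) :
  (x - y) ^+ 2 <= K * e -> (y - z) ^+ 2 <= L * e ->
  (x - z) ^+ 2 <= (2 * K + 2 * L) * e.
Proof.
by move=> h1 h2; have := sqr_ge0 (x - y - (y - z)); nra.
Qed.

(** The rate matters as much as the limit: it makes limits along infinite words
uniform. *)
Lemma geometric_steps (R : realType) (a : nat -> R) (M d : R) :
  0 <= d < 1 -> (forall n, `|a n.+1 - a n| <= M * d ^+ n) ->
  exists l, a n @[n --> \oo] --> l /\
    forall n, `|l - a n| <= M * d ^+ n / (1 - d).
Proof.
move=> /andP[d0 d1] step.
have d1' : 0 < 1 - d by rewrite subr_gt0.
pose e n := M * d ^+ n / (1 - d).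
have eS n : e n.+1 = e n - M * d ^+ n.
  by rewrite /e exprS; field; rewrite gt_eqF.
have M0 : 0 <= M by have := step 0%N; rewrite expr0 mulr1; exact: le_trans.
have e0 n : 0 <= e n by rewrite divr_ge0 ?mulr_ge0 ?exprn_ge0// ltW.
have e_cvg : e n @[n --> \oo] --> 0.
  rewrite -[X in _ --> X](mul0r (1 - d)^-1) -(mulr0 M).
  apply: cvgM; last exact: cvg_cst.
  by apply: cvgM; [exact: cvg_cst|apply: cvg_expr; rewrite ger0_norm].
pose lo n := a n - e n; pose up n := a n + e n.
have lo_homo : {homo lo : m n / (m <= n)%N >-> m <= n}.
  apply/nondecreasing_seqP => n; rewrite /lo eS.
  by have := step n; rewrite ler_norml => /andP[+ _]; lra.
have up_homo : {homo up : m n / (m <= n)%N >-> n <= m}.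
  apply/nonincreasing_seqP => n; rewrite /up eS.
  by have := step n; rewrite ler_norml => /andP[_ +]; lra.
have lo_cvg : cvg (lo n @[n --> \oo]).
  apply: nondecreasing_is_cvgn lo_homo _; exists (up 0%N) => _ [n _ <-].
  by apply: le_trans (up_homo _ _ (leq0n n)); rewrite /lo /up; have := e0 n; lra.
have a_cvg : a n @[n --> \oo] --> lim (lo n @[n --> \oo]).
  have -> : a = (fun n => lo n + e n) by apply/funext => n; rewrite /lo subrK.
  by rewrite -[X in _ --> X]addr0; apply: cvgD.
exists (lim (lo n @[n --> \oo])); split=> // n.
have up_cvg : up n @[n --> \oo] --> lim (lo n @[n --> \oo]).
  by rewrite -[X in _ --> X]addr0; apply: cvgD.
have := nondecreasing_cvgn_le lo_homo lo_cvg n.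
have := nonincreasing_cvgn_ge up_homo (cvgP _ up_cvg) n.
rewrite (cvg_lim _ up_cvg)// ler_norml /up /lo -/(e n) => h1 h2.
by apply/andP; split; move: h1 h2; lra.
Qed.

Section Oscillation.
Context (R : realType) (X : pmetricType R) (J : nat).
Variables (F : 'I_J -> X -> X) (pi : shift_space J -> X).
Variables (c : X -> X -> R) (r : 'I_J -> R).
Local Notation V0 := (V0 F pi).
Hypotheses (hX : self_similar_set F pi) (hpcf : post_critically_finite F pi).
Hypotheses (hconn : connected (~` V0)).
Hypotheses (hharm : regular_harmonic_structure F V0 c r) (J1 : (1 < J)%N).

Local Notation E0 := (energy0 V0 c).
Local Notation En := (energyn F V0 c r).
Local Notation E := (energy F V0 c r).
Local Notation dom := (dom_energy F V0 c r).
Local Notation Fw := (Fword F).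
Local Notation rw := (rword r).
Let Vfin : finite_set V0 := V0_finite hpcf.

Lemma ratio_upper : exists d, [/\ 0 < d, d < 1 & forall j, r j <= d].
Proof.
exists (\big[Num.max/2^-1]_j r j); split.
- apply: (@lt_le_trans _ _ 2^-1); first by rewrite invr_gt0.
  exact: bigmax_ge_id.
- apply/bigmax_ltP; split; first by lra.
  by move=> j _; exact: (ratio_lt1 hharm).
- by move=> j; exact: le_bigmax.
Qed.

Lemma ratio_lower : exists2 d, 0 < d <= 1 & forall j, d <= r j.
Proof.
exists (\big[Num.min/1]_j r j).
  apply/andP; split; last exact: bigmin_le_id.
  apply/bigmin_gtP; split; first by lra.
  by move=> j _; exact: (ratio_gt0 hharm).
by move=> j; exact: bigmin_le.
Qed.

Lemma rword_le_exp d w : 0 <= d -> (forall j, r j <= d) -> rw w <= d ^+ size w.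
Proof.
move=> d0 rd; elim: w => [|j w IH]; first by rewrite rword_nil.
by rewrite rword_cons exprS ler_pM// ltW ?(ratio_gt0 hharm) ?(rword_gt0 hharm).
Qed.

Lemma energy0_edge u p q : V0 p -> V0 q ->
  c p q * (u p - u q) ^+ 2 <= 2 * E0 u u.
Proof.
move=> Vp Vq; rewrite (energy0E _ Vfin) [leRHS]mulrA divff ?mul1r//.
have pV : p \in fset_set V0 by rewrite (fset_setB Vfin) mem_set.
have qV : q \in fset_set V0 by rewrite (fset_setB Vfin) mem_set.
have ge0 x y : x \in fset_set V0 -> y \in fset_set V0 ->
    0 <= c x y * ((u x - u y) * (u x - u y)).
  by move=> xV yV; rewrite mulr_ge0 ?(conductance_ge0 Vfin hharm)// -expr2 sqr_ge0.
rewrite (big_fsetD1 p)//= (big_fsetD1 q)//= -expr2 -addrA lerDl.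
apply: addr_ge0; rewrite big_seq; apply: sumr_ge0 => x.
  by rewrite in_fsetD1 => /andP[_ xV]; exact: ge0.
rewrite in_fsetD1 => /andP[_ xV]; rewrite big_seq; apply: sumr_ge0 => y yV.
exact: ge0.
Qed.

(** The points whose distance from [p] in the resistance sense is finite form
a union of connected components of the graph of positive conductances; the
indicator of this set has no energy, so irreducibility makes it constant. *)
Lemma boundary_oscillation_pair p q : V0 p -> V0 q ->
  exists K, forall u, (u p - u q) ^+ 2 <= K * E0 u u.
Proof.
move=> Vp Vq.
pose near x := `[< exists K, forall u, (u p - u x) ^+ 2 <= K * E0 u u >].
pose u x : R := (near x)%:R.
have E0u : E0 u u = 0.
  rewrite (energy0E _ Vfin); apply/eqP; rewrite mulf_eq0; apply/orP; right; apply/eqP.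
  rewrite big_seq big1// => x; rewrite (fset_setB Vfin) => /set_mem Vx.
  rewrite big_seq big1// => y; rewrite (fset_setB Vfin) => /set_mem Vy.
  have [->|cxy] := eqVneq (c x y) 0; first by rewrite mul0r.
  have step a b : V0 a -> V0 b -> c a b != 0 -> near a -> near b.
    move=> Va Vb cab /asboolP[K hK]; apply/asboolP.
    exists (2 * K + 2 * (2 / c a b)) => v; apply: sqr_chain (hK v) _.
    have c0 : 0 < c a b by rewrite lt_def cab (hs_ge0 hharm).
    by rewrite mulrAC ler_pdivlMr// mulrC energy0_edge.
  have cyx : c y x != 0 by rewrite -(hs_sym hharm).
  have eqn : near x = near y by apply/idP/idP; exact: step.
  by rewrite /u eqn subrr mul0r mulr0.
have nearp : near p.
  apply/asboolP; exists 1 => v; rewrite subrr expr0n mul1r/= -(energyn0 F c r Vfin).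
  exact: (energyn_ge0 Vfin hharm).
have := hs_irreducible hharm E0u Vp Vq; rewrite /u nearp.
by case: (boolP (near q)) => [/asboolP//|_ /eqP]; rewrite oner_eq0.
Qed.

Lemma boundary_oscillation : exists2 K, 0 < K &
  forall u p q, V0 p -> V0 q -> (u p - u q) ^+ 2 <= K * E0 u u.
Proof.
pose s := fset_set V0.
have mem x : V0 x -> x \in s by move=> Vx; rewrite (fset_setB Vfin); exact: mem_set.
have E0ge0 u : 0 <= E0 u u.
  by rewrite -(energyn0 F c r Vfin); exact: (energyn_ge0 Vfin hharm).
have [K K0 hK] : exists2 K, 0 < K & forall p, p \in s ->
    forall q, q \in s -> forall u, (u p - u q) ^+ 2 <= K * E0 u u.
  apply: common_bound => [p K L KL hK q qs u|p ps].
    by apply: le_trans (hK q qs u) _; exact: ler_wpM2r.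
  have [K _ hK] : exists2 K, 0 < K & forall q, q \in s ->
      forall u, (u p - u q) ^+ 2 <= K * E0 u u.
    apply: common_bound => [q K L KL hK u|q].
      by apply: le_trans (hK u) _; exact: ler_wpM2r.
    rewrite !(fset_setB Vfin) in ps * => qs.
    by apply: boundary_oscillation_pair; [exact: set_mem ps|exact: set_mem qs].
  by exists K.
exists K => // u p q Vp Vq; exact: hK (mem _ Vp) _ (mem _ Vq) u.
Qed.

Lemma energy0_le_energy1 u j : E0 (u \o F j) (u \o F j) <= r j * En 1 u u.
Proof.
rewrite -ler_pdivrMl ?(ratio_gt0 hharm)// (energynS F c r Vfin) (bigD1 j)//= (energyn0 F c r Vfin).
rewrite lerDl; apply: sumr_ge0 => i _.
by rewrite mulr_ge0 ?(energyn_ge0 Vfin hharm) ?invr_ge0 ?ltW ?(ratio_gt0 hharm).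
Qed.

(** The same argument one level down: inside a cell the boundary values are
compared by the level zero form, and from one cell to the next by a common
point, since the first-level cells are linked. *)
Lemma level1_oscillation : exists2 K, 0 < K &
  forall u i j p q, V0 p -> V0 q ->
    (u (F i p) - u (F j q)) ^+ 2 <= K * En 1 u u.
Proof.
have [K0 K0gt hK0] := boundary_oscillation.
have [b0 Vb0] := V0_nonempty hX hpcf hconn J1.
have Ege0 u : 0 <= En 1 u u by exact: (energyn_ge0 Vfin hharm).
have cell u j p q : V0 p -> V0 q ->
    (u (F j p) - u (F j q)) ^+ 2 <= K0 * En 1 u u.
  move=> Vp Vq; apply: le_trans (hK0 (u \o F j) p q Vp Vq) _.
  rewrite ler_pM2l//; apply: le_trans (energy0_le_energy1 u j) _.
  by apply: ler_piMl; [exact: Ege0|rewrite ltW// (ratio_lt1 hharm)].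
have base i j : exists K, forall u,
    (u (F i b0) - u (F j b0)) ^+ 2 <= K * En 1 u u.
  pose A := [set j | exists K, forall u,
    (u (F i b0) - u (F j b0)) ^+ 2 <= K * En 1 u u].
  have [//|nAj] := pselect (A j).
  have Ai : A i by exists 0 => u; rewrite subrr expr0n mul0r.
  have [k [l [x [y [[K hK] Al eqF]]]]] := cells_linked hX hpcf hconn Ai nAj.
  have kl : k != l by apply/eqP => kl; apply: Al; rewrite -kl; exists K.
  have Vx := cells_meet hX kl eqF.
  have lk : l != k by rewrite eq_sym.
  have Vy := cells_meet hX lk (esym eqF).
  exfalso; apply: Al.
  exists (2 * K + 2 * (2 * K0 + 2 * K0)) => u.
  apply: sqr_chain (hK u) _; apply: (@sqr_chain _ _ (u (F k x))).
    exact: cell.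
  by rewrite eqF; exact: cell.
have [K Kgt hK] : exists2 K, 0 < K & forall i, i \in enum 'I_J ->
    forall j u, (u (F i b0) - u (F j b0)) ^+ 2 <= K * En 1 u u.
  apply: common_bound => [i K L KL hK j u|i _].
    by apply: le_trans (hK j u) _; exact: ler_wpM2r.
  have [K _ hK] : exists2 K, 0 < K & forall j, j \in enum 'I_J ->
      forall u, (u (F i b0) - u (F j b0)) ^+ 2 <= K * En 1 u u.
    apply: common_bound => [j K L KL hK u|j _]; last exact: base.
    by apply: le_trans (hK u) _; exact: ler_wpM2r.
  by exists K => j u; apply: hK; rewrite mem_enum.
exists (2 * K0 + 2 * (2 * K + 2 * K0)); first by lra.
move=> u i j p q Vp Vq.
apply: (@sqr_chain _ _ (u (F i b0))); first exact: cell.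
apply: (@sqr_chain _ _ (u (F j b0))); last exact: cell.
by apply: hK; rewrite mem_enum.
Qed.

Lemma energy_cell_le w u : dom u -> E (u \o Fw w) (u \o Fw w) <= rw w * E u u.
Proof.
have cF j := ss_cont hX (j := j).
elim: w u => [|j w IH] u du; first by rewrite rword_nil mul1r.
have duj : dom (u \o F j) by exact: (dom_compF Vfin hharm).
apply: le_trans (IH _ duj) _; rewrite rword_cons -mulrA [leRHS]mulrCA.
rewrite ler_pM2l ?(rword_gt0 hharm)// -ler_pdivrMl ?(ratio_gt0 hharm)//.
rewrite [leRHS](energy_selfsimilar Vfin hharm); last 2 first.
- by move=> i; exact: (dom_compF Vfin hharm).
- by move=> i; exact: (dom_compF Vfin hharm).
rewrite (bigD1 j)//= lerDl; apply: sumr_ge0 => i _.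
apply: mulr_ge0; first by rewrite invr_ge0 ltW ?(ratio_gt0 hharm).
by apply: (energy_ge0 Vfin hharm); exact: (dom_compF Vfin hharm).
Qed.

(** Along the cells that shrink to a point the increments of a function of
finite energy decrease geometrically, because the part of the energy on a cell,
rescaled to [X], is at most the ratio of the cell times the whole energy. *)
Lemma oscillation : exists2 K, 0 < K &
  forall u, dom u -> forall x y, (u x - u y) ^+ 2 <= K * E u u.
Proof.
have [K1 K1gt hK1] := level1_oscillation.
have [b0 Vb0] := V0_nonempty hX hpcf hconn J1.
have [i0 [q0 [Vq0 eqb0]]] := V0_pred hX Vb0.
have [d [d0 d1 rd]] := ratio_upper.
pose s := Num.sqrt d.
have s0 : 0 < s by rewrite sqrtr_gt0.
have s1 : s < 1 by rewrite -sqrtr1 ltr_sqrt.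
have ss : s ^+ 2 = d by rewrite sqr_sqrtr ?ltW.
exists (4 * K1 / (1 - s) ^+ 2).
  by rewrite divr_gt0 ?mulr_gt0 ?exprn_gt0 ?subr_gt0.
move=> u du.
pose M := Num.sqrt (K1 * E u u).
have E0 : 0 <= E u u by exact: (energy_ge0 Vfin hharm).
have toB x : `|u x - u b0| <= M / (1 - s).
  have [om <-] := ss_pi_surj hX x.
  pose a n := u (Fw (prefix_word om n) b0).
  have step n : `|a n.+1 - a n| <= M * s ^+ n.
    rewrite /a prefix_wordS Fword_rcons -{2}eqb0.
    set w := prefix_word om n; set v := u \o Fw w.
    have dv : dom v by apply: (dom_compFw Vfin hharm) => // j; exact: (ss_cont hX).
    rewrite -[_ - _]/(v (F (om n) b0) - v (F i0 q0)) -sqrtr_sqr.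
    rewrite -[s ^+ n]ger0_norm ?exprn_ge0 ?(ltW s0)// -sqrtr_sqr.
    rewrite -sqrtrM; last by rewrite mulr_ge0// ltW.
    apply: ler_wsqrtr; apply: le_trans (hK1 v _ _ _ _ Vb0 Vq0) _.
    rewrite -mulrA ler_pM2l// exprAC ss.
    apply: le_trans (energyn_le Vfin hharm 1 dv) _.
    apply: le_trans (energy_cell_le w du) _; rewrite mulrC ler_wpM2l//.
    apply: le_trans (rword_le_exp w (ltW d0) rd) _.
    by rewrite size_prefix_word.
  have [|l [al bound]] := geometric_steps _ step; first by rewrite ltW.
  have al' : a n @[n --> \oo] --> u (pi om).
    apply: (cvg_comp (fun n => Fw (prefix_word om n) b0) u (G := nbhs (pi om))).
      exact: (cells_cvg hX).
    exact: (dom_continuous du).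
  have -> : u (pi om) = l by rewrite -(cvg_lim _ al')// -(cvg_lim _ al).
  by have := bound 0%N; rewrite expr0 mulr1.
move=> x y.
have : `|u x - u y| <= 2 * (M / (1 - s)).
  rewrite -(subrKA (u b0)); apply: le_trans (ler_normD _ _) _.
  by rewrite [X in _ + X]distrC mulr_natl mulr2n lerD.
move=> h; rewrite -[leLHS]real_normK ?num_real//.
have M0 : 0 <= M / (1 - s) by rewrite divr_ge0 ?sqrtr_ge0 ?subr_ge0 ?(ltW s1).
have /le_trans : `|u x - u y| ^+ 2 <= (2 * (M / (1 - s))) ^+ 2.
  by rewrite lerXn2r ?nnegrE// mulr_ge0.
apply.
rewrite !exprMn sqr_sqrtr; last by rewrite mulr_ge0// ltW.
rewrite exprVn le_eqVlt; apply/orP; left.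
by apply/eqP; ring.
Qed.

End Oscillation.

(** * Splines *)

Section Splines.
Context (R : realType) (X : pmetricType R) (J : nat).
Variables (F : 'I_J -> X -> X) (pi : shift_space J -> X).
Variables (c : X -> X -> R) (r : 'I_J -> R).
Local Notation V0 := (V0 F pi).
Hypotheses (hX : self_similar_set F pi) (hpcf : post_critically_finite F pi).
Hypotheses (hconn : connected (~` V0)).
Hypotheses (hharm : regular_harmonic_structure F V0 c r) (J1 : (1 < J)%N).

Local Notation E0 := (energy0 V0 c).
Local Notation En := (energyn F V0 c r).
Local Notation E := (energy F V0 c r).
Local Notation dom := (dom_energy F V0 c r).
Local Notation Fw := (Fword F).
Local Notation rw := (rword r).
Let Vfin : finite_set V0 := V0_finite hpcf.

(** The words of one level of the partition are the leaves of a finite tree.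
A property or a quantity that passes from the successors of each word to the
word therefore passes from the level to the empty word. *)
Lemma partition_tree k : exists L : seq (seq 'I_J),
  [/\ forall w, w \in L <-> Theta r k w,
      forall P : seq 'I_J -> Prop, (forall w, (forall j, P (rcons w j)) -> P w) ->
        (forall w, w \in L -> P w) -> P [::] &
      forall G : seq 'I_J -> R, (forall w, G w = \sum_j G (rcons w j)) ->
        \sum_(w <- L) G w = G [::]].
Proof.
pose e : R := expR (- k%:R).
have [d [d0 d1 rd]] := ratio_upper hharm.
have [N hN] : exists N, d ^+ N <= e.
  have : d ^+ n @[n --> \oo] --> 0 by apply: cvg_expr; rewrite ger0_norm// ltW.
  move=> /cvgr_le -/(_ e (expR_gt0 _))[N _ hN]; exists N.
  exact: hN N (leqnn N).
pose leaf w := rw w <= e.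
have leafN w : (N <= size w)%N -> leaf w.
  move=> Nw; apply: le_trans (rword_le_exp hharm w (ltW d0) rd) _.
  by apply: le_trans hN; apply: ler_wiXn2l => //; exact: ltW.
pose fix refine (n : nat) (w : seq 'I_J) {struct n} : seq (seq 'I_J) :=
  if n is n'.+1 then
    if leaf w then [:: w]
    else flatten [seq refine n' (rcons w j) | j <- enum 'I_J]
  else [:: w].
have refineS n w : refine n.+1 w = if leaf w then [:: w]
    else flatten [seq refine n (rcons w j) | j <- enum 'I_J] by [].
pose inner w := forall v j, w = rcons v j -> e < rw v.
have inn_rcons w j : ~~ leaf w -> inner (rcons w j).
  move=> nl v i /rcons_inj[<- _]; by rewrite ltNge.
have sound n w u : (N <= n + size w)%N -> inner w -> u \in refine n w ->
    Theta r k u.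
  elim: n w => [|n IH] w Nw inw.
    by rewrite inE => /eqP ->; split=> //; exact: leafN.
  rewrite refineS; case: ifPn => [lw|nlw].
    by rewrite inE => /eqP ->.
  move=> /flatten_mapP[j _]; apply: IH; last exact: inn_rcons.
  by rewrite size_rcons addnS -addSn.
have complete n w u : (N <= n + size w)%N -> Theta r k (w ++ u) ->
    w ++ u \in refine n w.
  elim: u n w => [|j u IH] n w Nw.
    rewrite cats0 => -[lw _]; case: n {Nw} => [|n]; first by rewrite inE.
    by rewrite refineS /leaf lw inE.
  rewrite -cat_rcons => Tw.
  have nlw : ~~ leaf w.
    rewrite /leaf -ltNge; case/lastP: u Tw {IH} => [|u i] [_ Tw].
      by rewrite cats0 in Tw; exact: Tw.
    have := Tw (rcons w j ++ u) i; rewrite -rcons_cat => /(_ erefl).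
    move=> /lt_le_trans; apply; rewrite rword_cat rword_rcons -mulrA.
    rewrite ler_piMr ?ltW ?(rword_gt0 hharm)//.
    have rj := ltW (ratio_lt1 hharm j); have ru := rword_le1 hharm u.
    have rj0 := ratio_gt0 hharm j; have ru0 := rword_gt0 hharm u.
    by apply: le_lt_trans (ler_piMr (ltW rj0) ru) _; exact: (ratio_lt1 hharm).
  case: n Nw => [|n] Nw; first by rewrite leafN in nlw.
  rewrite refineS (negPf nlw); apply/flatten_mapP; exists j; first by rewrite mem_enum.
  by apply: IH => //; rewrite size_rcons addnS -addSn.
exists (refine N [::]); split.
- move=> w; split; first by apply: sound; rewrite ?addn0// => v j; case: v.
  by apply: (complete N [::] w); rewrite addn0.
- move=> P PS; have : forall n w, (forall u, u \in refine n w -> P u) -> P w.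
    elim=> [|n IH] w; first by apply; rewrite inE.
    rewrite refineS; case: ifPn => [_|_ Pu]; first by apply; rewrite inE.
    apply: PS => j; apply: IH => u ju; apply: Pu.
    by apply/flatten_mapP; exists j; rewrite ?mem_enum.
  exact.
- move=> G GS; have : forall n w, \sum_(u <- refine n w) G u = G w.
    elim=> [|n IH] w; first by rewrite big_seq1.
    rewrite refineS; case: ifPn => _; first by rewrite big_seq1.
    rewrite big_flatten big_map big_enum/= GS.
    by apply: eq_bigr => j _; exact: IH.
  exact.
Qed.

Lemma theta_cover k x : exists2 w, Theta r k w & range (Fw w) x.
Proof.
have [L [LT LP _]] := partition_tree k.
have := LP (fun v => range (Fw v) x -> exists2 w, Theta r k w & range (Fw w) x).
apply; last by exists x.
- move=> v IH [y _ yx].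
  have [[//|j [|//]] _ [z _ zy]] := cell_cover hX 1 y.
  by apply: (IH j); exists z => //; rewrite Fword_rcons -yx -zy.
- by move=> w /LT Tw wx; exists w.
Qed.

Lemma theta_le k w : Theta r k w -> rw w <= expR (- k%:R).
Proof. by case. Qed.

Lemma theta_ge k w d : (forall j, d <= r j) -> 0 < d <= 1 -> Theta r k w ->
  d * expR (- k%:R) <= rw w.
Proof.
move=> dr /andP[d0 d1]; case/lastP: w => [|w j] [_ Tw].
  rewrite rword_nil mulr_ile1 ?expR_ge0 ?(ltW d0)//.
rewrite rword_rcons mulrC ler_pM ?expR_ge0 ?(ltW d0)//.
exact/ltW/(Tw w j).
Qed.

(** Since every point has a neighbourhood covered by the cells of a given level
that contain it, smallness of the oscillation on cells gives continuity. *)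
Lemma continuous_of_cells (g : X -> R) :
  (forall e : R, 0 < e -> exists n, forall w x y, size w = n ->
     `|g (Fw w x) - g (Fw w y)| < e) -> continuous g.
Proof.
move=> osc x; apply/cvgrPdist_lt => e e0; have [n hn] := osc e e0.
pose bad : set X := \bigcup_(w in [set w : n.-tuple 'I_J | ~ range (Fw w) x]) range (Fw w).
have bad_closed : closed bad.
  apply: closed_bigcup; first exact: finite_finset.
  by move=> w _; exact: (cell_closed hX).
have : nbhs x (~` bad).
  apply: open_nbhs_nbhs; split; first by rewrite openC.
  by move=> [w /= nx wx].
apply: filterS => y nby.
have [w wn wy] := cell_cover hX n y.
have [wx|nwx] := pselect (range (Fw w) x).
  by move: wx wy => [a _ <-] [b _ <-]; exact: hn.
case: nby; have wn' : size w == n by apply/eqP.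
by exists (Tuple wn').
Qed.

Lemma critical_shift_V0 om n : critical_set F pi om ->
  V0 (pi (shift_word om n.+1)).
Proof. by move=> crit; exists (shift_word om n.+1) => //; exists n => //; exists om. Qed.

Lemma V0_code p : V0 p -> exists om, pi om = p /\
  forall n, V0 (pi (shift_word om n)).
Proof.
move=> [_ [m _ [ka crit <-]] <-].
exists (shift_word ka m.+1); split=> // n.
have -> : shift_word (shift_word ka m.+1) n = shift_word ka (m + n).+1.
  by apply/funext => i; rewrite /shift_word addSn addnA.
exact: critical_shift_V0.
Qed.

Section LimitFunction.
Variables (e : seq 'I_J -> X -> R) (M : R).
Hypothesis e_compat : forall w j p, V0 p -> e (rcons w j) p = e w (F j p).
Hypothesis e_step : forall w j p q, V0 p -> V0 q ->
  (e (rcons w j) p - e w q) ^+ 2 <= M * rw w.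

(** Compatible data on the boundaries of all cells, whose increments from a cell
to its successors are controlled by the ratio of the cell, are the boundary
values of a continuous function. Its value at the point coded by an infinite
word is the limit of the data along the word; two codes of the same point give
the same limit because, after their first difference, the tails of both code
boundary points, on which the data no longer change. *)
Lemma limit_function : exists g : X -> R, continuous g /\
  forall w p, V0 p -> g (Fw w p) = e w p.
Proof.
have [b0 Vb0] := V0_nonempty hX hpcf hconn J1.
have [d [d0 d1 rd]] := ratio_upper hharm.
have M0 : 0 <= M.
  have [j] : exists j : 'I_J, True by exists (Ordinal J1).
  have := e_step [::] (Ordinal J1) Vb0 Vb0; rewrite rword_nil mulr1.
  by move=> h _; apply: le_trans h; exact: sqr_ge0.
pose s := Num.sqrt d; pose m := Num.sqrt M.
have s0 : 0 < s by rewrite sqrtr_gt0.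
have s1 : s < 1 by rewrite -sqrtr1 ltr_sqrt.
have m0 : 0 <= m by exact: sqrtr_ge0.
have ss : s ^+ 2 = d by rewrite sqr_sqrtr ?ltW.
have step w j p q : V0 p -> V0 q ->
    `|e (rcons w j) p - e w q| <= m * s ^+ size w.
  move=> Vp Vq; rewrite -ler_sqr ?nnegrE ?mulr_ge0 ?exprn_ge0 ?(ltW s0)//.
  rewrite real_normK ?num_real// exprMn sqr_sqrtr// exprAC ss.
  apply: le_trans (e_step w j Vp Vq) _; rewrite ler_wpM2l//.
  exact: (rword_le_exp hharm w (ltW d0) rd).
pose a om n := e (prefix_word om n) b0.
pose l om := lim (a om n @[n --> \oo]).
have la om n : `|l om - a om n| <= m * s ^+ n / (1 - s).
  have [|n'|x [ax bound]] := @geometric_steps _ (a om) m s.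
  - by rewrite (ltW s0).
  - by rewrite /a prefix_wordS; have := step (prefix_word om n') (om n') _ _ Vb0 Vb0;
      rewrite size_prefix_word.
  - by rewrite /l (cvg_lim _ ax).
have small (t : R) : 0 < t -> exists n, 3 * (m * s ^+ n / (1 - s)) < t.
  move=> t0.
  have h : 3 * (m * s ^+ n / (1 - s)) @[n --> \oo] --> 0.
    rewrite -[X in _ --> X](mulr0 3); apply: cvgM; first exact: cvg_cst.
    rewrite -[X in _ --> X](mul0r (1 - s)^-1) -(mulr0 m).
    apply: cvgM; last exact: cvg_cst.
    by apply: cvgM; [exact: cvg_cst|apply: cvg_expr; rewrite ger0_norm// ltW].
  by move/cvgr_lt : h => /(_ t t0)[N _ hN]; exists N; exact: hN N (leqnn N).
have s1' : 0 < 1 - s by rewrite subr_gt0.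
have lq om n q : V0 q ->
    `|l om - e (prefix_word om n) q| <= 3 * (m * s ^+ n / (1 - s)).
  move=> Vq; set A := m * s ^+ n / (1 - s).
  have B1 := la om n.+1; rewrite /a prefix_wordS in B1.
  have B2 := step (prefix_word om n) (om n) b0 q Vb0 Vq.
  rewrite size_prefix_word in B2.
  have ms : 0 <= m * s ^+ n by rewrite mulr_ge0// exprn_ge0// ltW.
  have B3 : m * s ^+ n <= A.
    by rewrite /A ler_pdivlMr// ler_piMr// gerBl ltW.
  have B4 : m * s ^+ n.+1 / (1 - s) <= A.
    rewrite /A ler_pM2r ?invr_gt0// exprS mulrCA ler_piMl//; exact: ltW.
  have := ler_distD (e (rcons (prefix_word om n) (om n)) b0) (l om)
    (e (prefix_word om n) q).
  rewrite -/A in B1 B2 B3 B4 *; move: B1 B2 B3 B4.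
  set x := `|_|; set y := `|_|; set z := `|_|; move=> B1 B2 B3 B4 B5.
  have A0 : 0 <= A by exact: le_trans ms B3.
  by lra.
have stationary om n : (forall i, V0 (pi (shift_word om (n + i)))) ->
    l om = e (prefix_word om n) (pi (shift_word om n)).
  move=> VV; have cst i : e (prefix_word om (n + i)) (pi (shift_word om (n + i))) =
      e (prefix_word om n) (pi (shift_word om n)).
    elim: i => [|i IH]; first by rewrite addn0.
    rewrite -IH addnS prefix_wordS e_compat; last by rewrite -addnS.
    by rewrite (ss_pi_compat hX) seq_cons_shift.
  apply/eqP; rewrite -subr_eq0 -normr_eq0 eq_le normr_ge0 andbT leNgt.
  apply/negP => /small[N hN].
  have := lq om (n + N)%N _ (VV N); rewrite cst => /le_lt_trans.
  have decr : 3 * (m * s ^+ (n + N) / (1 - s)) <= 3 * (m * s ^+ N / (1 - s)).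
    rewrite ler_pM2l// ler_pM2r ?invr_gt0// ler_wpM2l// exprD.
    by rewrite ler_piMl ?exprn_ge0 ?exprn_ile1 ?(ltW s0) ?(ltW s1).
  by move=> /(_ _ (le_lt_trans decr hN)); rewrite ltxx.
have well_defined om om' : pi om = pi om' -> l om = l om'.
  move=> eqpi.
  have [->//|neq] := pselect (om = om').
  have /existsNP ex : ~ forall n, om n = om' n by move=> h; apply: neq; apply/funext.
  have ex' : exists n, om n != om' n by have [n /eqP] := ex; exists n.
  case: (ex_minnP ex') => n nn minn.
  have eqp : prefix_word om n = prefix_word om' n.
    apply/eq_in_map => i; rewrite mem_iota add0n => /andP[_ ilt].
    by apply/eqP; apply: contraTT ilt => /minn; rewrite -leqNgt.
  have eqs : pi (shift_word om n) = pi (shift_word om' n).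
    apply: (Fword_inj hX (w := prefix_word om n)).
    by rewrite -(pi_prefix hX) [in RHS]eqp -(pi_prefix hX).
  have eqF : F (om n) (pi (shift_word om n.+1)) = F (om' n) (pi (shift_word om' n.+1)).
    by rewrite !(ss_pi_compat hX) !seq_cons_shift.
  have tail x y : x n != y n ->
      F (x n) (pi (shift_word x n.+1)) = F (y n) (pi (shift_word y n.+1)) ->
      forall i, V0 (pi (shift_word x (n.+1 + i))).
    move=> xy eqxy i.
    have crit : critical_set F pi (shift_word x n).
      exists (x n), (y n); split=> //; rewrite -seq_cons_shift -(ss_pi_compat hX).
      by split; [exists (pi (shift_word x n.+1))|rewrite eqxy;
        exists (pi (shift_word y n.+1))].
    have := critical_shift_V0 i crit; congr (V0 (pi _)).
    by apply/funext => t; rewrite /shift_word addnA addnS addSn.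
  rewrite (stationary om n.+1); last exact: tail eqF.
  rewrite (stationary om' n.+1); last by apply: tail (esym eqF); rewrite eq_sym.
  rewrite !prefix_wordS -eqp.
  have V1 := tail _ _ nn eqF 0%N; rewrite addn0 in V1.
  have nn' : om' n != om n by rewrite eq_sym.
  have V2 := tail _ _ nn' (esym eqF) 0%N; rewrite addn0 in V2.
  by rewrite !e_compat// eqF.
pose g x := l (projT1 (cid (ss_pi_surj hX x))).
have gpi om : g (pi om) = l om.
  by apply: well_defined; case: cid.
pose catw w (ka : shift_space J) : shift_space J :=
  fun i => if (i < size w)%N then nth (ka 0%N) w i else ka (i - size w)%N.
have prefix_cat w ka : prefix_word (catw w ka) (size w) = w.
  apply: (@eq_from_nth _ (ka 0%N)); first by rewrite size_prefix_word.
  by move=> i; rewrite size_prefix_word => ilt; rewrite nth_mkseq// /catw ilt.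
have shift_cat w ka i : shift_word (catw w ka) (size w + i) = shift_word ka i.
  apply/funext => t; rewrite /shift_word /catw ltnNge -addnA leq_addr/=.
  by rewrite addKn.
have shift_cat0 w ka : shift_word (catw w ka) (size w) = ka.
  by rewrite -[size w]addn0 shift_cat; apply/funext.
have pi_cat w ka : Fw w (pi ka) = pi (catw w ka).
  by rewrite (pi_prefix hX (catw w ka) (size w)) prefix_cat shift_cat0.
exists g; split.
  apply: continuous_of_cells => t t0; have [n hn] := small t t0.
  exists n => w x y wn.
  have near z : `|g (Fw w z) - e w b0| <= m * s ^+ n / (1 - s).
    have [ka <-] := ss_pi_surj hX z; rewrite pi_cat gpi.
    by have := la (catw w ka) n; rewrite /a -wn prefix_cat.
  have A0 : 0 <= m * s ^+ n / (1 - s) by exact: le_trans (near x).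
  apply: le_lt_trans hn; rewrite -(subrKA (e w b0)).
  apply: le_trans (ler_normD _ _) _; rewrite [X in _ + X]distrC.
  by have := near x; have := near y; lra.
move=> w p Vp; have [ka [kap VV]] := V0_code Vp.
rewrite -kap pi_cat gpi (stationary _ (size w)) ?prefix_cat ?shift_cat0//.
by move=> i; rewrite shift_cat.
Qed.

End LimitFunction.

Lemma energy0_ext u v u' v' : (forall p, V0 p -> u p = u' p) ->
  (forall p, V0 p -> v p = v' p) -> E0 u v = E0 u' v'.
Proof.
move=> equ eqv; rewrite !(energy0E _ Vfin); congr (_ * _).
rewrite big_seq [RHS]big_seq; apply: eq_bigr => p.
rewrite (fset_setB Vfin) => /set_mem Vp.
rewrite big_seq [RHS]big_seq; apply: eq_bigr => q.
by rewrite (fset_setB Vfin) => /set_mem Vq; rewrite !equ ?eqv.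
Qed.

Definition total_conductance : R :=
  2^-1 * \sum_(p <- fset_set V0) \sum_(q <- fset_set V0) c p q.

Lemma total_conductance_ge0 : 0 <= total_conductance.
Proof.
apply: mulr_ge0 => //; rewrite big_seq; apply: sumr_ge0 => p pV.
by rewrite big_seq; apply: sumr_ge0 => q qV; exact: (conductance_ge0 Vfin hharm).
Qed.

Lemma energy0_le_total u (D : R) :
  (forall p q, V0 p -> V0 q -> (u p - u q) ^+ 2 <= D) ->
  E0 u u <= total_conductance * D.
Proof.
move=> leD; rewrite (energy0E _ Vfin) /total_conductance -mulrA ler_pM2l//.
rewrite mulr_suml big_seq [leRHS]big_seq; apply: ler_sum => p pV.
rewrite mulr_suml big_seq [leRHS]big_seq; apply: ler_sum => q qV.
apply: ler_wpM2l; first exact: (conductance_ge0 Vfin hharm).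
rewrite -expr2; move: pV qV; rewrite !(fset_setB Vfin) => /set_mem Vp /set_mem Vq.
exact: leD.
Qed.

Lemma harmonic_extension (u : X -> R) : exists v : X -> R,
  (forall p, V0 p -> v p = u p) /\ En 1 v v = E0 u u.
Proof. by have [_ [v vu ev]] := hs_renorm hharm u; exists v. Qed.

(** Above level [k] the data are the restrictions of [a] to the boundaries of
the cells; from the cells of level [k] downwards they are extended
harmonically. *)
Lemma spline k (a : X -> R) (D : R) : (forall x, 0 <= a x <= D) ->
  exists g : X -> R, [/\ dom g,
    forall x, vertices F V0 (Theta r k) x -> g x = a x &
    forall w, Theta r k w -> E (g \o Fw w) (g \o Fw w) =
      E0 (a \o Fw w) (a \o Fw w)].
Proof.
move=> aD.
have D0 : 0 <= D by have /andP[+ +] := aD point; exact: le_trans.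
have osc x y : (a x - a y) ^+ 2 <= D ^+ 2.
  rewrite -(real_normK (num_real (a x - a y))) lerXn2r ?nnegrE//.
  by have /andP[? ?] := aD x; have /andP[? ?] := aD y; rewrite ler_norml; lra.
have [K K0 hK] := level1_oscillation hX hpcf hconn hharm J1.
have [d d01 dr] := ratio_lower hharm.
have /andP[d0 d1] := d01.
pose ek : R := expR (- k%:R).
have ek0 : 0 < ek by exact: expR_gt0.
have [H HP] := choice harmonic_extension.
have Hb u p : V0 p -> H u p = u p by exact: (HP u).1.
have HE u : En 1 (H u) (H u) = E0 u u by exact: (HP u).2.
pose above w := ek < rw w.
pose fix er (s : seq 'I_J) {struct s} : X -> R :=
  if above (rev s) then a \o Fw (rev s) else
  H (if s is j :: s' then er s' \o F j else a).
have erE s : er s = if above (rev s) then a \o Fw (rev s) else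
    H (if s is j :: s' then er s' \o F j else a) by case: s.
pose e w := er (rev w).
have e_above w : above w -> e w = a \o Fw w.
  by rewrite /e erE revK => ->.
have e_nil : ~~ above [::] -> e [::] = H a by rewrite /e erE => /negPf ->.
have e_below w j : ~~ above (rcons w j) -> e (rcons w j) = H (e w \o F j).
  by rewrite /e rev_rcons erE rev_cons revK => /negPf ->.
have above_parent w j : above (rcons w j) -> above w.
  move=> /lt_le_trans; apply; rewrite rword_rcons ler_piMr//.
    exact/ltW/(rword_gt0 hharm).
  exact/ltW/(ratio_lt1 hharm).
have e_compat w j p : V0 p -> e (rcons w j) p = e w (F j p).
  move=> Vp; have [ab|nab] := boolP (above (rcons w j)).
    by rewrite e_above// e_above ?(above_parent w j)//= Fword_rcons.
  by rewrite e_below// Hb.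
have e_energy1 w : ~~ above w -> En 1 (e w) (e w) = E0 (e w) (e w).
  case/lastP: w => [|w j] nab.
    by rewrite e_nil// HE; apply: energy0_ext => p Vp; rewrite Hb.
  by rewrite e_below// HE; apply: energy0_ext => p Vp; rewrite Hb.
have e_theta w p : Theta r k w -> V0 p -> e w p = a (Fw w p).
  case/lastP: w => [|w j] [wle Tw] Vp.
    by rewrite e_nil ?Hb// /above -leNgt.
  rewrite e_compat// e_above /= -?Fword_rcons//; exact: Tw w j erefl.
pose M := total_conductance * D ^+ 2 / (d * ek).
have tot0 := total_conductance_ge0.
have dek0 : 0 < d * ek by rewrite mulr_gt0.
have M0 : 0 <= M by rewrite divr_ge0 ?(ltW dek0)// mulr_ge0 ?sqr_ge0.
have M_big w : d * ek <= rw w -> total_conductance * D ^+ 2 <= M * rw w.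
  move=> h; rewrite /M [leRHS]mulrAC ler_pdivlMr//.
  by rewrite ler_wpM2l// mulr_ge0// sqr_ge0.
have ek1 : ek <= 1 by rewrite -[leRHS]expR0 ler_expR oppr_le0.
have e_bound w : E0 (e w) (e w) <= M * rw w.
  elim/last_ind: w => [|w j IH].
    apply: le_trans (M_big [::] _); last first.
      by rewrite rword_nil mulr_ile1 ?(ltW d0) ?(ltW ek0).
    have -> : E0 (e [::]) (e [::]) = E0 a a.
      have [ab|nab] := boolP (above [::]); first by rewrite e_above.
      by rewrite e_nil//; apply: energy0_ext => p Vp; rewrite Hb.
    by apply: energy0_le_total => p q _ _; exact: osc.
  rewrite (@energy0_ext _ _ (e w \o F j) (e w \o F j)); last 2 first.
  - by move=> p Vp; rewrite e_compat.
  - by move=> p Vp; rewrite e_compat.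
  have [ab|nab] := boolP (above w).
    rewrite e_above//; apply: le_trans (M_big (rcons w j) _).
      by apply: energy0_le_total => p q _ _; exact: osc.
    rewrite rword_rcons mulrC ler_pM ?(ltW d0) ?(ltW ek0)//.
    exact: ltW.
  apply: le_trans (energy0_le_energy1 hpcf hharm (e w) j) _.
  rewrite e_energy1// rword_rcons mulrA [leRHS]mulrC ler_pM2l//.
  exact: (ratio_gt0 hharm).
pose M' := Num.max (D ^+ 2 / ek) (K * M).
have e_step w j p q : V0 p -> V0 q ->
    (e (rcons w j) p - e w q) ^+ 2 <= M' * rw w.
  move=> Vp Vq; rewrite e_compat//; have [ab|nab] := boolP (above w).
    rewrite e_above//; apply: le_trans (osc _ _) _.
    apply: (@le_trans _ _ (D ^+ 2 / ek * rw w)).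
      by rewrite mulrAC ler_pdivlMr// ler_wpM2l ?sqr_ge0// ltW.
    by rewrite ler_wpM2r ?le_max ?lexx// ltW// (rword_gt0 hharm).
  have [i [q' [Vq' <-]]] := V0_pred hX Vq.
  apply: le_trans (hK _ _ _ _ _ Vp Vq') _; rewrite e_energy1//.
  apply: (@le_trans _ _ (K * M * rw w)).
    by rewrite -mulrA ler_pM2l.
  by rewrite ler_wpM2r ?le_max ?lexx ?orbT// ltW// (rword_gt0 hharm).
have [g [g_cont ge]] := limit_function e_compat e_step.
have g_energy m w : ~~ above w ->
    En m (g \o Fw w) (g \o Fw w) = E0 (e w) (e w).
  elim: m w => [|m IH] w nab.
    rewrite (energyn0 F c r Vfin).
    by apply: energy0_ext => p Vp /=; exact: ge.
  rewrite (energynS F c r Vfin) -e_energy1// (energynS F c r Vfin).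
  apply: eq_bigr => j _; congr (_ * _).
  have -> : (g \o Fw w) \o F j = g \o Fw (rcons w j).
    by apply/funext => x /=; rewrite Fword_rcons.
  rewrite IH; last by apply: contra nab; exact: above_parent.
  by rewrite (energyn0 F c r Vfin); apply: energy0_ext => p Vp; exact: e_compat.
have theta_above w : Theta r k w -> ~~ above w.
  by move=> [wle _]; rewrite /above -leNgt.
have theta_E w m : Theta r k w -> En m (g \o Fw w) (g \o Fw w) =
    E0 (a \o Fw w) (a \o Fw w).
  move=> Tw; rewrite g_energy ?theta_above//.
  by apply: energy0_ext => p Vp; exact: e_theta.
exists g; split.
- have [L [LT LP _]] := partition_tree k.
  apply: (LP (fun w => dom (g \o Fw w))) => [w domw|w /LT Tw].
    apply: (dom_of_compF Vfin hharm) => [x|j].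
      by apply: continuous_comp; [exact: (Fword_continuous hX)|exact: g_cont].
    have -> : (g \o Fw w) \o F j = g \o Fw (rcons w j); last exact: domw.
    by apply/funext => x /=; rewrite Fword_rcons.
  apply/(domP Vfin hharm); split.
    by move=> x; apply: continuous_comp; [exact: (Fword_continuous hX)|exact: g_cont].
  by exists (E0 (a \o Fw w) (a \o Fw w)) => m; rewrite theta_E.
- move=> _ [w Tw [p Vp <-]]; rewrite ge// e_theta//.
- move=> w Tw; rewrite /energy; under eq_fun do rewrite theta_E//.
  by apply: cvg_lim => //; exact: cvg_cst.
Qed.

End Splines.

(** * Integration of bounded measurable functions *)

Section Integration.
Context (R : realType) (X : pmetricType R).
Hypothesis Xcompact : compact [set: X].
Variable mu : probability (borel X) R.

Definition bounded_measurable (f : borel X -> R) : Prop :=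
  measurable_fun setT f /\ exists M, forall x, `|f x| <= M.

Lemma open_borel (A : set X) : open A -> measurable (A : set (borel X)).
Proof. by move=> oA; exact: sub_sigma_algebra. Qed.

Lemma closed_borel (A : set X) : closed A -> measurable (A : set (borel X)).
Proof.
move=> cA; rewrite -[A]setCK; apply: measurableC; apply: open_borel.
by rewrite openC.
Qed.

Lemma continuous_bounded_measurable (f : X -> R) :
  continuous f -> bounded_measurable f.
Proof.
move=> cf; split.
  apply: (measurability _ (RGenOpens.measurableE R)) => _ [_ [a [b ->]] <-].
  rewrite setTI; apply: open_borel.
  by move/continuousP : cf; apply; exact: interval_open.
have := @compact_bounded _ _ (f @` setT).
have cfX : compact (f @` setT).
  by apply: continuous_compact => //; exact: continuous_subspaceT.
move=> /(_ cfX)[M [_ hM]]; exists (`|M| + 1) => x.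
by apply: (hM (`|M| + 1)); [rewrite ltr_pwDr// ler_norm|exists x].
Qed.

Lemma bounded_measurable_cst (a : R) : bounded_measurable (fun=> a).
Proof. by split; [exact: measurable_cst|exists `|a|]. Qed.

Lemma bounded_measurable_indic (A : set (borel X)) : measurable A ->
  bounded_measurable (\1_A : borel X -> R).
Proof.
move=> mA; split; first exact: measurable_indic.
by exists 1 => x; rewrite indicE; case: (_ \in _); rewrite ?normr1 ?normr0.
Qed.

Lemma bounded_measurable_lin (a b : R) f g : bounded_measurable f ->
  bounded_measurable g -> bounded_measurable (fun x => a * f x + b * g x).
Proof.
move=> [mf [M hM]] [mg [N hN]]; split.
  by apply: measurable_funD; apply: measurable_funM => //; exact: measurable_cst.
exists (`|a| * M + `|b| * N) => x; apply: le_trans (ler_normD _ _) _.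
by rewrite !normrM lerD// ler_wpM2l.
Qed.

Lemma bounded_measurableM f g : bounded_measurable f -> bounded_measurable g ->
  bounded_measurable (fun x => f x * g x).
Proof.
move=> [mf [M hM]] [mg [N hN]]; split; first exact: measurable_funM.
by exists (M * N) => x; rewrite normrM ler_pM.
Qed.

Lemma bounded_measurable_sum (I : Type) (s : seq I) (a : I -> R) (f : I -> borel X -> R) :
  (forall i, bounded_measurable (f i)) ->
  bounded_measurable (fun x => \sum_(i <- s) a i * f i x).
Proof.
move=> bf; elim: s => [|i s IH].
  by under eq_fun do rewrite big_nil; exact: bounded_measurable_cst.
under eq_fun do rewrite big_cons.
by have := bounded_measurable_lin (a i) 1 (bf i) IH; under eq_fun do rewrite mul1r.
Qed.

Lemma bounded_measurable_integrable f : bounded_measurable f ->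
  mu.-integrable setT (EFin \o f).
Proof.
move=> [mf [M hM]]; apply: measurable_bounded_integrable => //.
  by have := ltry (1 : R); rewrite -(probability_setT mu).
exists M; split; first exact: num_real.
by move=> N MN x _; apply: le_trans (hM x) _; exact: ltW.
Qed.

Lemma Rint_lin (a b : R) f g : bounded_measurable f -> bounded_measurable g ->
  \int[mu]_x (a * f x + b * g x) = a * \int[mu]_x f x + b * \int[mu]_x g x.
Proof.
move=> bf bg.
have := bounded_measurable_lin a 0 bf bf; under eq_fun do rewrite mul0r addr0.
have := bounded_measurable_lin b 0 bg bg; under eq_fun do rewrite mul0r addr0.
move=> /bounded_measurable_integrable ig /bounded_measurable_integrable if_.
by rewrite RintegralD// !RintegralZl//; exact: bounded_measurable_integrable.
Qed.

Lemma Rint_sum (I : Type) (s : seq I) (a : I -> R) (f : I -> borel X -> R) :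
  (forall i, bounded_measurable (f i)) ->
  \int[mu]_x (\sum_(i <- s) a i * f i x) = \sum_(i <- s) a i * \int[mu]_x f i x.
Proof.
move=> bf; elim: s => [|i s IH].
  rewrite big_nil; under eq_Rintegral do rewrite big_nil.
  by rewrite Rintegral_cst// mul0r.
under eq_Rintegral do rewrite big_cons.
have := Rint_lin (a i) 1 (bf i) (bounded_measurable_sum s a bf).
by under eq_Rintegral do rewrite mul1r; rewrite IH mul1r big_cons.
Qed.

Lemma Rint_le f g : bounded_measurable f -> bounded_measurable g ->
  (forall x, f x <= g x) -> \int[mu]_x f x <= \int[mu]_x g x.
Proof.
by move=> bf bg le; apply: le_Rintegral => //; exact: bounded_measurable_integrable.
Qed.

Lemma Rint_cst (a : R) : \int[mu]_x a = a.
Proof. transitivity (a * fine (mu setT)); first exact: Rintegral_cst.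
by rewrite (probability_setT mu) mulr1. Qed.

Lemma Rint_ge0 (f : borel X -> R) : (forall x, 0 <= f x) -> 0 <= \int[mu]_x f x.
Proof. by move=> f0; exact: Rintegral_ge0. Qed.

Lemma bounded_measurable_Lfun2 f : bounded_measurable f -> f \in Lfun mu 2%:E.
Proof.
move=> bf; have [mf _] := bf; have := bounded_measurable_integrable (bounded_measurableM bf bf).
move=> /integrableP[_ fin].
rewrite inE/=; apply/andP; split; first exact: mem_set.
apply: mem_set => /=.
rewrite /finite_norm unlock poweR_lty//.
move: fin; congr (_ < _)%E; apply: eq_integral => x _ /=.
by rewrite powR_mulrn// -expr2 -normrX.
Qed.

Lemma continuous_borel_measurable (h : X -> X) : continuous h ->
  measurable_fun setT (h : borel X -> borel X).
Proof.
move=> ch; apply: (@measurability _ _ (borel X) (borel X) setT h (@open X)) => //.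
move=> _ [A oA <-]; rewrite setTI; apply: open_borel.
by move/continuousP : ch; exact.
Qed.

Lemma bounded_measurable_comp (f : borel X -> R) (h : X -> X) : continuous h ->
  bounded_measurable f -> bounded_measurable (f \o h).
Proof.
move=> ch [mf [M hM]]; split; last by exists M => x; exact: hM.
exact: (measurableT_comp mf (continuous_borel_measurable ch)).
Qed.

End Integration.

Section SelfSimilarMeasure.
Context (R : realType) (X : pmetricType R) (J : nat).
Variables (F : 'I_J -> X -> X) (pi : shift_space J -> X) (r : 'I_J -> R) (S : R).
Variable mu : probability (borel X) R.
Hypotheses (hX : self_similar_set F pi) (r0 : forall j, 0 < r j).
Hypothesis hmu : self_similar_measure F r S mu.

Let cF j : continuous (F j).
Proof. exact: (ss_cont hX). Qed.

Let push j : {measure set (borel X) -> \bar R} :=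
  @measure_function_pushforward__canonical__measure_function_Measure
    _ _ (borel X) (borel X) _ mu (F j) (continuous_borel_measurable (@cF j)).

Let weighted n : {measure set (borel X) -> \bar R} :=
  if insub n is Some j then mscale (NngNum (powR_ge0 (r j) S)) (push j)
  else mzero.

Let weightedE (j : 'I_J) : weighted j = mscale (NngNum (powR_ge0 (r j) S)) (push j).
Proof. by rewrite /weighted valK. Qed.

(** The measure is the mixture of its images under the maps [F j]. *)
Lemma Rint_selfsimilar (f : borel X -> R) : bounded_measurable f ->
  (forall x, 0 <= f x) ->
  \int[mu]_x f x = \sum_j r j `^ S * \int[mu]_x f (F j x).
Proof.
move=> bf f0; have [mf _] := bf.
have mfE : measurable_fun setT (EFin \o f) by exact/measurable_EFinP.
have f0E x : [set: borel X] x -> (0 <= (EFin \o f) x)%E by rewrite lee_fin.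
have key : (\int[mu]_x (f x)%:E = \sum_j (r j `^ S)%:E * \int[mu]_x (f (F j x))%:E)%E.
  rewrite (@eq_measure_integral _ _ _ _ (msum weighted J)); last first.
    move=> A mA _; apply: etrans (hmu mA) _; apply: eq_bigr => j _.
    by rewrite weightedE.
  rewrite ge0_integral_measure_sum//; apply: eq_bigr => j _.
  rewrite weightedE ge0_integral_mscale//; congr (_ * _)%E.
  apply: etrans (ge0_integral_pushforward (continuous_borel_measurable (@cF j))
    mu measurableT mfE _) _; first by move=> y _; exact: f0E.
  by rewrite preimage_setT.
have fin j : (\int[mu]_x (f (F j x))%:E)%E \is a fin_num.
  apply: integrable_fin_num => //; apply: bounded_measurable_integrable.
  exact: (bounded_measurable_comp (@cF j) bf).
rewrite /Rintegral key; under eq_bigr do rewrite -(fineK (fin _)) -EFinM.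
by rewrite sumEFin.
Qed.

Lemma cell_measure_ge w : rword r w `^ S <= \int[mu]_x \1_(range (Fword F w)) x.
Proof.
have bm v : bounded_measurable (\1_(range (Fword F v)) : borel X -> R).
  by apply: bounded_measurable_indic; apply: closed_borel; exact: (cell_closed hX).
elim: w => [|j w IH].
  rewrite /rword big_nil powR1 (_ : range _ = setT) ?indicT ?Rint_cst//.
  by apply/seteqP; split=> // x _; exists x.
rewrite (Rint_selfsimilar (bm (j :: w))); last by move=> x; rewrite indicE ler0n.
rewrite (bigD1 j)//= /rword big_cons powRM; last 2 first.
- exact: ltW.
- by apply: prodr_ge0 => i _; exact: ltW.
rewrite -[leLHS]addr0; apply: lerD.
  rewrite ler_wpM2l ?powR_ge0//; apply: le_trans IH _.
  apply: Rint_le => //; first exact: (bounded_measurable_comp (@cF j) (bm (j :: w))).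
  move=> x; rewrite !indicE ler_nat; case: (boolP (x \in _)) => // /set_mem[y _ <-].
  by rewrite mem_set//; exists y.
by apply: sumr_ge0 => i _; rewrite mulr_ge0 ?powR_ge0// Rint_ge0// => x; rewrite indicE ler0n.
Qed.

End SelfSimilarMeasure.

(** * The weighted energy inequality *)

Lemma cosh_quadratic (R : realType) (s : R) : `|s| <= 2^-1 ->
  expR s + expR (- s) - 2 <= 3 * s ^+ 2.
Proof.
rewrite ler_norml => /andP[s1 s2].
have inv_bound (t : R) : - 2^-1 <= t <= 2^-1 -> expR t * (1 - t) <= 1.
  move=> /andP[_ t2]; have := expR_ge1Dx (- t).
  by rewrite expRN -[X in _ -> _ <= X](mulfV (lt0r_neq0 (expR_gt0 t))) ler_pM2l ?expR_gt0.
have h1 := inv_bound s; have h2 := inv_bound (- s).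
have {}h1 : expR s * (1 - s) <= 1 by apply: h1; apply/andP.
have {}h2 : expR (- s) * (1 - - s) <= 1 by apply: h2; lra.
have p1 := expR_gt0 s; have p2 := expR_gt0 (- s).
have b1 : expR s <= (1 - s)^-1 by rewrite -[leRHS]mul1r ler_pdivlMr//; lra.
have b2 : expR (- s) <= (1 - - s)^-1 by rewrite -[leRHS]mul1r ler_pdivlMr//; lra.
have d1 : 0 < 1 - s by lra.
have d2 : 0 < 1 - - s by lra.
have : (1 - s)^-1 + (1 - - s)^-1 - 2 <= 3 * s ^+ 2.
  have -> : (1 - s)^-1 + (1 - - s)^-1 - 2 = 2 * s ^+ 2 / (1 - s ^+ 2).
    by field; apply/and3P; split; apply/eqP => h; nra.
  have q0 := sqr_ge0 s; have q4 : s ^+ 2 <= 4^-1 by nra.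
  rewrite ler_pdivrMr; last by lra.
  by move: q0 q4; set q := s ^+ 2; nra.
by lra.
Qed.

Lemma expR_lipschitz (R : realType) (a b M : R) : a <= M -> b <= M ->
  `|expR a - expR b| <= expR M * `|a - b|.
Proof.
wlog ba : a b / b <= a => [hwlog aM bM|aM bM].
  by case: (leP b a) => [|/ltW] ba; [|rewrite distrC [X in _ <= _ * X]distrC]; exact: hwlog.
rewrite !ger0_norm ?subr_ge0 ?ler_expR//.
apply: (@le_trans _ _ (expR a * (a - b))); last first.
  by rewrite ler_wpM2r ?subr_ge0// ler_expR.
have -> : expR b = expR a * expR (b - a) by rewrite -expRD addrC subrK.
rewrite -[X in X - _]mulr1 -mulrBr ler_pM2l ?expR_gt0//.
by have := expR_ge1Dx (b - a); lra.
Qed.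

Section Davies.
Context (R : realType) (X : pmetricType R) (J : nat).
Variables (F : 'I_J -> X -> X) (pi : shift_space J -> X).
Variables (c : X -> X -> R) (r : 'I_J -> R) (S : R) (mu : probability (borel X) R).
Local Notation V0 := (V0 F pi).
Hypotheses (hX : self_similar_set F pi) (hpcf : post_critically_finite F pi).
Hypotheses (hconn : connected (~` V0)).
Hypotheses (hharm : regular_harmonic_structure F V0 c r) (J1 : (1 < J)%N).
Hypotheses (hS : \sum_(j < J) r j `^ S = 1) (hmu : self_similar_measure F r S mu).

Local Notation E0 := (energy0 V0 c).
Local Notation En := (energyn F V0 c r).
Local Notation E := (energy F V0 c r).
Local Notation dom := (dom_energy F V0 c r).
Local Notation Fw := (Fword F).
Local Notation rw := (rword r).
Let Vfin : finite_set V0 := V0_finite hpcf.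
Let rgt0 j : 0 < r j := ratio_gt0 hharm j.
Let rwgt0 w : 0 < rw w := rword_gt0 hharm w.

Variables (K d : R).
Hypotheses (K0 : 0 < K)
  (hK : forall u, dom u -> forall x y, (u x - u y) ^+ 2 <= K * E u u).
Hypotheses (d01 : 0 < d <= 1) (dr : forall j, d <= r j).

Lemma bounded_measurable_dom u : dom u -> bounded_measurable u.
Proof.
by move=> du; apply: (continuous_bounded_measurable (ss_compact hX)); case: du.
Qed.

Lemma bounded_measurable_sqr u : bounded_measurable u ->
  bounded_measurable (fun x : borel X => u x ^+ 2).
Proof.
move=> bu; rewrite (_ : (fun x => _) = fun x => u x * u x); last first.
  by apply/funext => x; rewrite expr2.
exact: bounded_measurableM.
Qed.

Lemma dimension_gt0 : 0 < S.
Proof.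
rewrite ltNge; apply/negP => S0.
have : (2 : R) <= \sum_(j < J) r j `^ S.
  apply: (@le_trans _ _ (\sum_(j < J) 1)); last first.
    apply: ler_sum => j _; rewrite -[leLHS](powRr0 (r j)).
    by rewrite ger_powR// rgt0 ltW// (ratio_lt1 hharm).
  by rewrite sumr_const card_ord ler_nat.
by rewrite hS; lra.
Qed.

Lemma sqr_le_energy_mean u x : dom u ->
  u x ^+ 2 <= 2 * K * E u u + 2 * \int[mu]_y (u y ^+ 2).
Proof.
move=> du; have bu := bounded_measurable_dom du.
rewrite -(Rint_cst mu (u x ^+ 2)).
have <- : \int[mu]_y ((2 * K * E u u) * 1 + 2 * u y ^+ 2) =
    2 * K * E u u + 2 * \int[mu]_y (u y ^+ 2).
  rewrite (Rint_lin mu _ _ (bounded_measurable_cst X 1) (bounded_measurable_sqr bu)).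
  by rewrite Rint_cst mulr1.
apply: Rint_le; first exact: bounded_measurable_cst.
  apply: bounded_measurable_lin; first exact: bounded_measurable_cst.
  exact: bounded_measurable_sqr.
move=> y; have := hK du x y; have := sqr_ge0 (u x - 2 * u y); nra.
Qed.

Lemma cell_mean_le w f : bounded_measurable f -> (forall x, 0 <= f x) ->
  rw w `^ S * \int[mu]_x f (Fw w x) <= \int[mu]_x f x.
Proof.
elim: w f => [|j w IH] f bf f0; first by rewrite rword_nil powR1 mul1r.
have bj := bounded_measurable_comp (ss_cont hX (j := j)) bf.
rewrite (Rint_selfsimilar hX hmu bf f0) rword_cons powRM ?(ltW (rgt0 j)) ?(ltW (rwgt0 w))// -mulrA.
rewrite (bigD1 j)//= -[leLHS]addr0 lerD//.
  by apply: ler_wpM2l; [exact: powR_ge0|exact: (IH _ bj (fun x => f0 _))].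
by apply: sumr_ge0 => i _; rewrite mulr_ge0 ?powR_ge0 ?Rint_ge0.
Qed.

Let dk k : R := d * expR (- k%:R).

Lemma dk_gt0 k : 0 < dk k.
Proof. by rewrite mulr_gt0 ?expR_gt0//; case/andP: d01. Qed.

(** The preceding inequality on a cell of level [k] around [x]: passing to the
cell shrinks the energy by the ratio of the cell and enlarges the mean square at
most by the reciprocal of the measure of the cell. *)
Lemma sqr_le_energy_mean_level k u x : dom u ->
  u x ^+ 2 <= 2 * K * expR (- k%:R) * E u u +
              2 * dk k `^ (- S) * \int[mu]_y (u y ^+ 2).
Proof.
move=> du; have [w Tw [z _ <-]] := theta_cover hX hharm k x.
have duw : dom (u \o Fw w).
  by apply: (dom_compFw Vfin hharm) => // j; exact: (ss_cont hX).
apply: le_trans (sqr_le_energy_mean z duw) _; apply: lerD.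
  rewrite -!mulrA ler_pM2l// ler_pM2l//.
  apply: le_trans (energy_cell_le hX hpcf hharm w du) _.
  by rewrite ler_wpM2r ?(energy_ge0 Vfin hharm)// theta_le.
rewrite -mulrA ler_pM2l//.
have bu := bounded_measurable_sqr (bounded_measurable_dom du).
have := cell_mean_le w bu (fun x => sqr_ge0 _).
have rS : 0 < rw w `^ S by rewrite powR_gt0.
rewrite -ler_pdivlMl// => /le_trans; apply.
rewrite ler_wpM2r ?Rint_ge0//; first by move=> y; exact: sqr_ge0.
rewrite powRN lef_pV2 ?posrE ?powR_gt0 ?dk_gt0//.
rewrite ge0_ler_powR ?nnegrE ?(ltW dimension_gt0) ?(ltW (dk_gt0 k)) ?(ltW (rwgt0 w))//.
exact: (theta_ge dr d01 Tw).
Qed.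

Definition weighted (t : R) (g u : X -> R) (x : X) : R := expR (t * g x) * u x.

(** Boundedness of [g] and [u] makes the product rule for increments enough. *)
Lemma dom_weighted t g u : dom g -> dom u -> dom (weighted t g u).
Proof.
move=> dg du.
have [_ [G hG]] := bounded_measurable_dom dg.
have [_ [U hU]] := bounded_measurable_dom du.
pose A := expR (`|t| * G).
have U0 : 0 <= U by exact: le_trans (hU point).
have tg x : t * g x <= `|t| * G.
  by apply: le_trans (ler_norm _) _; rewrite normrM ler_wpM2l.
apply: (@dom_of_increments _ _ _ _ _ _ _ Vfin hharm _ g u
  (2 * (U * (A * `|t|)) ^+ 2) (2 * A ^+ 2)) => //.
- move=> x; apply: cvgM; last exact: (dom_continuous du).
  apply: (@continuous_comp _ _ _ (fun x => t * g x) expR); last exact: continuous_expR.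
  by apply: cvgM; [exact: cvg_cst|exact: (dom_continuous dg)].
- by rewrite mulr_ge0 ?sqr_ge0.
- by rewrite mulr_ge0 ?sqr_ge0.
move=> x y.
rewrite -[leLHS]real_normK ?num_real//.
apply: (@le_trans _ _ ((U * (A * `|t|) * `|g x - g y| + A * `|u x - u y|) ^+ 2)).
  rewrite lerXn2r ?nnegrE// ?addr_ge0 ?mulr_ge0 ?expR_ge0//.
  have -> : weighted t g u x - weighted t g u y =
      (expR (t * g x) - expR (t * g y)) * u y + expR (t * g x) * (u x - u y).
    by rewrite /weighted; ring.
  apply: le_trans (ler_normD _ _) _; rewrite !normrM.
  apply: lerD; last by rewrite ler_wpM2r// ger0_norm ?expR_ge0// ler_expR.
  rewrite mulrC -mulrA ler_pM// -mulrA.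
  apply: le_trans (expR_lipschitz (tg x) (tg y)) _.
  by rewrite -mulrBr normrM.
apply: le_trans (sqr_comb_le _ _ _ _) _.
by rewrite !real_normK ?num_real.
Qed.

(** The two-point form of the identity behind Davies' method: conjugating the
form by a weight costs only the square of the increment of its logarithm. *)
Lemma energy_weighted_local t g u V : dom g -> dom u ->
  (forall x y, `|t * (g x - g y)| <= 2^-1) ->
  (forall x, weighted t g u x ^+ 2 <= V) ->
  E (weighted t g u) (weighted t g u) - 3 * t ^+ 2 * V * E g g <=
  E u (weighted (2 * t) g u).
Proof.
move=> dg du small vV.
have dv := dom_weighted t dg du; have df := dom_weighted (2 * t) dg du.
have := @energy_le_of_increments _ _ _ _ _ _ _ Vfin hharm 1 (- (3 * t ^+ 2 * V)) 1
  u g (weighted t g u) (weighted (2 * t) g u) du dg dv df.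
rewrite !mul1r mulNr; apply => x y; rewrite !mul1r.
have wE z : weighted (2 * t) g u z = expR (t * g z) * weighted t g u z.
  by rewrite /weighted mulrA -expRD; congr (expR _ * _); ring.
have uE z : u z = expR (- (t * g z)) * weighted t g u z.
  by rewrite /weighted mulrA -expRD addNr expR0 mul1r.
rewrite !wE (uE x) (uE y).
have := vV x; have := vV y; set p := weighted t g u x; set q := weighted t g u y.
move=> qV pV.
have -> : (expR (- (t * g x)) * p - expR (- (t * g y)) * q) *
    (expR (t * g x) * p - expR (t * g y) * q) =
    p ^+ 2 + q ^+ 2 -
    (expR (t * (g x - g y)) + expR (- (t * (g x - g y)))) * (p * q).
  rewrite (mulrBr t) opprB !expRD !expRN.
  have := expR_gt0 (t * g x); have := expR_gt0 (t * g y).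
  by move=> /lt0r_neq0 n1 /lt0r_neq0 n2; field; apply/andP.
have := cosh_quadratic (small x y).
have : 2 <= expR (t * (g x - g y)) + expR (- (t * (g x - g y))).
  have := expR_ge1Dx (t * (g x - g y)); have := expR_ge1Dx (- (t * (g x - g y))).
  by lra.
set C := expR _ + expR _ => C2 Cq.
have pq : p * q <= V by have := sqr_ge0 (p - q); nra.
have V0' : 0 <= V by exact: le_trans (sqr_ge0 _) pV.
have : (C - 2) * (p * q) <= 3 * t ^+ 2 * V * (g x - g y) ^+ 2.
  apply: (@le_trans _ _ ((C - 2) * V)).
    by rewrite ler_wpM2l// subr_ge0.
  apply: le_trans (ler_wpM2r V0' Cq) _.
  by rewrite exprMn le_eqVlt; apply/orP; left; apply/eqP; ring.
by rewrite !expr2; lra.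
Qed.

Section Level.
Variables (k : nat) (g : X -> R) (Mg t : R).
Hypotheses (dg : dom g)
  (gE : forall w, Theta r k w -> E (g \o Fw w) (g \o Fw w) <= Mg)
  (tM : 6 * t ^+ 2 * K * Mg <= 1).

Lemma partition_energy u v (L : seq (seq 'I_J)) : dom u -> dom v ->
  (forall G : seq 'I_J -> R, (forall w, G w = \sum_j G (rcons w j)) ->
        \sum_(w <- L) G w = G [::]) ->
  \sum_(w <- L) (rw w)^-1 * E (u \o Fw w) (v \o Fw w) = E u v.
Proof.
move=> du dv LG.
rewrite (LG (fun w => (rw w)^-1 * E (u \o Fw w) (v \o Fw w))).
  by rewrite rword_nil invr1 mul1r.
move=> w.
have cF j : continuous (F j) by exact: (ss_cont hX).
have dFw z x : dom z -> dom (z \o Fw x) by move=> dz; exact: (dom_compFw Vfin hharm).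
have Fr (z : X -> R) j : z \o Fw (rcons w j) = (z \o Fw w) \o F j.
  by apply/funext => x /=; rewrite Fword_rcons.
rewrite (energy_selfsimilar Vfin hharm); last 2 first.
- by move=> j; rewrite -Fr; exact: dFw.
- by move=> j; rewrite -Fr; exact: dFw.
rewrite mulr_sumr; apply: eq_bigr => j _.
by rewrite rword_rcons invfM mulrA !Fr.
Qed.

Lemma partition_mean f (L : seq (seq 'I_J)) : bounded_measurable f ->
  (forall x, 0 <= f x) ->
  (forall G : seq 'I_J -> R, (forall w, G w = \sum_j G (rcons w j)) ->
        \sum_(w <- L) G w = G [::]) ->
  \sum_(w <- L) rw w `^ S * \int[mu]_x f (Fw w x) = \int[mu]_x f x.
Proof.
move=> bf f0 LG.
rewrite (LG (fun w => rw w `^ S * \int[mu]_x f (Fw w x))).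
  by rewrite rword_nil powR1 mul1r.
move=> w; have bw := bounded_measurable_comp (Fword_continuous hX (w := w)) bf.
rewrite (Rint_selfsimilar hX hmu bw) => [|x]; last exact: f0.
rewrite mulr_sumr; apply: eq_bigr => j _.
rewrite rword_rcons powRM ?(ltW (rgt0 j)) ?(ltW (rwgt0 w))// -mulrA; congr (_ * (_ * _)).
by apply: eq_Rintegral => x _ /=; rewrite Fword_rcons.
Qed.

(** The error terms of the cells of level [k] are absorbed: the part with the
energy by the choice of [t], the part with the mean square into the constant,
which is of the order of the reciprocal of the time scale of level [k]. *)
Lemma davies u : dom u ->
  - (K^-1 * dk k `^ (- (S + 1))) * \int[mu]_x (weighted t g u x ^+ 2) <=
  E u (weighted (2 * t) g u).
Proof.
move=> du; set v := weighted t g u; set f := weighted (2 * t) g u.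
have dv : dom v := dom_weighted t dg du; have df : dom f := dom_weighted (2 * t) dg du.
have [L [LT _ LG]] := partition_tree hharm k.
have bv := bounded_measurable_sqr (bounded_measurable_dom dv).
rewrite -(partition_energy du df LG).
rewrite -(partition_mean bv (fun x => sqr_ge0 _) LG) mulr_sumr.
rewrite big_seq [leRHS]big_seq; apply: ler_sum => w /LT Tw.
have cF j : continuous (F j) by exact: (ss_cont hX).
have dFw z : dom z -> dom (z \o Fw w) by move=> dz; exact: (dom_compFw Vfin hharm).
have Eg := gE Tw; have Eg0 := energy_ge0 Vfin hharm (dFw _ dg).
have Ev0 := energy_ge0 Vfin hharm (dFw _ dv).
pose I := \int[mu]_x (v (Fw w x) ^+ 2).
have I0 : 0 <= I by apply: Rint_ge0 => x; exact: sqr_ge0.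
pose V := 2 * K * E (v \o Fw w) (v \o Fw w) + 2 * I.
have osc x y : `|t * ((g \o Fw w) x - (g \o Fw w) y)| <= 2^-1.
  rewrite -ler_sqr ?nnegrE ?invr_ge0// real_normK ?num_real// exprMn.
  have h := hK (dFw _ dg) x y.
  apply: (@le_trans _ _ (t ^+ 2 * (K * Mg))).
    rewrite ler_wpM2l ?sqr_ge0//; apply: le_trans h _.
    by rewrite ler_pM2l.
  by move: tM; lra.
have vV x : weighted t (g \o Fw w) (u \o Fw w) x ^+ 2 <= V.
  exact: (sqr_le_energy_mean x (dFw _ dv)).
have := energy_weighted_local (dFw _ dg) (dFw _ du) osc vV.
rewrite -[weighted t (g \o Fw w) _]/(v \o Fw w).
rewrite -[weighted (2 * t) (g \o Fw w) _]/(f \o Fw w) => loc.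
have V0' : 0 <= V by exact: le_trans (sqr_ge0 _) (vV point).
have step1 : - (6 * t ^+ 2 * Mg * I) <= E (u \o Fw w) (f \o Fw w).
  apply: le_trans loc.
  have : 3 * t ^+ 2 * V * E (g \o Fw w) (g \o Fw w) <= 3 * t ^+ 2 * V * Mg.
    by apply: ler_wpM2l => //; apply: mulr_ge0 => //; rewrite mulr_ge0 ?sqr_ge0.
  have : 6 * t ^+ 2 * K * Mg * E (v \o Fw w) (v \o Fw w) <=
      E (v \o Fw w) (v \o Fw w) by exact: ler_piMl.
  by rewrite /V; lra.
have step2 : 6 * t ^+ 2 * Mg * I <= K^-1 * I.
  by rewrite ler_wpM2r// -[leRHS]mul1r ler_pdivlMr// mulrAC.
have step3 : - (K^-1 * I) <= E (u \o Fw w) (f \o Fw w).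
  by apply: le_trans step1; rewrite lerN2.
apply: (@le_trans _ _ ((rw w)^-1 * - (K^-1 * I))); last first.
  by rewrite ler_pM2l ?invr_gt0.
have key : (rw w)^-1 <= dk k `^ (- (S + 1)) * rw w `^ S.
  have -> : (rw w)^-1 = rw w `^ (- (S + 1)) * rw w `^ S.
    rewrite -powRD; last by apply/implyP => _; rewrite gt_eqF.
    by rewrite opprD addrAC addNr add0r powR_inv1// ltW.
  rewrite ler_wpM2r ?powR_ge0// !powRN lef_pV2 ?posrE ?powR_gt0 ?dk_gt0//.
  apply: ge0_ler_powR; rewrite ?nnegrE ?(ltW (dk_gt0 k)) ?(ltW (rwgt0 w))//.
    by rewrite addr_ge0// ltW// dimension_gt0.
  exact: (theta_ge dr d01 Tw).
have KI0 : 0 <= K^-1 * I by rewrite mulr_ge0// invr_ge0 ltW.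
have := ler_wpM2l KI0 key; rewrite mulrN mulNr lerN2 -/I [(rw w)^-1 * _]mulrC.
by congr (_ <= _); ring.
Qed.

End Level.
End Davies.

(** * Estimates from the eigenfunction expansion *)

Lemma is_derive_exp_term (R : realType) (A m x : R) :
  is_derive x 1 (fun t => A * expR (- (m * t))) (- (m * A * expR (- (m * x)))).
Proof.
have h0 : is_derive x 1 (fun t : R => (- m) *: t) ((- m) *: (1 : R)).
  exact: is_deriveZ.
have h : is_derive x 1 (fun t : R => - m * t) (- m) := is_derive_eq h0 (mulr1 _).
have h2 : is_derive x 1 (fun t => expR (- m * t)) (- m * expR (- m * x)).
  have h' := @is_derive1_comp _ expR (fun t : R => - m * t) x _ _ (is_derive_expR _) h.
  by apply: (is_derive_eq h'); rewrite mulrC.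
have -> : (fun t => A * expR (- (m * t))) = (fun t => A * expR (- m * t)).
  by apply/funext => t; rewrite mulNr.
have h3 : is_derive x 1 (fun t => A *: expR (- m * t)) (A *: (- m * expR (- m * x))).
  exact: is_deriveZ.
by apply: (is_derive_eq h3); rewrite /GRing.scale/= !mulNr; ring.
Qed.

Lemma is_derive_exp_sum (R : realType) (I : Type) (s : seq I) (A m : I -> R) (x : R) :
  is_derive x 1 (fun t => \sum_(i <- s) A i * expR (- (m i * t)))
    (\sum_(i <- s) - (m i * A i * expR (- (m i * x)))).
Proof.
elim: s => [|i s IH].
  rewrite big_nil; under eq_fun do rewrite big_nil.
  exact: is_derive_cst.
rewrite big_cons; under eq_fun do rewrite big_cons.
exact: (is_deriveD (is_derive_exp_term (A i) (m i) x) IH).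
Qed.

(** The hypothesis says that the derivative of the sum of exponentials is
nonpositive. *)
Lemma exp_sum_le (R : realType) (I : Type) (s : seq I) (A m : I -> R) (t : R) :
  0 <= t ->
  (forall x, 0 <= \sum_(i <- s) m i * A i * expR (- (m i * x))) ->
  \sum_(i <- s) A i * expR (- (m i * t)) <= \sum_(i <- s) A i.
Proof.
move=> t0 dge0; pose f (x : R) := \sum_(i <- s) A i * expR (- (m i * x)).
have df (x : R) : is_derive x 1 f (\sum_(i <- s) - (m i * A i * expR (- (m i * x)))).
  exact: is_derive_exp_sum.
have f0 : f 0 = \sum_(i <- s) A i.
  by apply: eq_bigr => i _; rewrite mulr0 oppr0 expR0 mulr1.
have cf : {within `[0, t], continuous f}.
  apply: derivable_within_continuous => x _.
  by have [] := df x.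
have [z _ fz] := MVT_segment t0 (fun x _ => df x) cf.
rewrite -f0 -/(f t) -subr_le0 fz subr0 sumrN mulNr oppr_le0.
by rewrite mulr_ge0.
Qed.

Section Spectral.
Context (R : realType) (X : pmetricType R) (J : nat).
Variables (F : 'I_J -> X -> X) (pi : shift_space J -> X).
Variables (c : X -> X -> R) (r : 'I_J -> R) (S : R) (mu : probability (borel X) R).
Local Notation V0 := (V0 F pi).
Hypotheses (hX : self_similar_set F pi) (hpcf : post_critically_finite F pi).
Hypotheses (hconn : connected (~` V0)).
Hypotheses (hharm : regular_harmonic_structure F V0 c r) (J1 : (1 < J)%N).
Hypotheses (hS : \sum_(j < J) r j `^ S = 1) (hmu : self_similar_measure F r S mu).

Local Notation E := (energy F V0 c r).
Local Notation dom := (dom_energy F V0 c r).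
Local Notation Fw := (Fword F).
Local Notation rw := (rword r).
Let Vfin : finite_set V0 := V0_finite hpcf.

Variables (K d : R).
Hypotheses (K0 : 0 < K)
  (hK : forall u, dom u -> forall x y, (u x - u y) ^+ 2 <= K * E u u).
Hypotheses (d01 : 0 < d <= 1) (dr : forall j, d <= r j).

Variables (phi : nat -> X -> R) (lam : nat -> R).
Hypothesis hphi : dirichlet_eigenbasis F V0 c r mu phi lam.

Lemma eigen_dom j : dom (phi j).
Proof. by have [_ _ /(_ j)[]] := hphi. Qed.

Lemma eigen_V0 j p : V0 p -> phi j p = 0.
Proof. by have [_ + _] := hphi; exact. Qed.

Lemma eigen_bounded_measurable j : bounded_measurable (phi j).
Proof. exact: (bounded_measurable_dom hX (eigen_dom j)). Qed.

Lemma eigen_orthonormal i j : \int[mu]_x (phi i x * phi j x) = (i == j)%:R.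
Proof. by have [[_ + _] _ _] := hphi; exact. Qed.

Lemma eigen_energy j v : dom v -> (forall p, V0 p -> v p = 0) ->
  E (phi j) v = lam j * \int[mu]_x (phi j x * v x).
Proof.
move=> dv v0; have [_ _ /(_ j)[_ _ ->]] := hphi => //.
have bv := bounded_measurable_dom hX dv.
have bm := bounded_measurableM (eigen_bounded_measurable j) bv.
have := Rint_lin mu (- lam j) 0 bm bm; rewrite mul0r addr0 mulNr => h.
rewrite -[RHS]opprK -h; congr (- _); apply: eq_Rintegral => x _ /=.
by rewrite mul0r addr0 mulrA.
Qed.

Lemma eigenvalue_ge0 j : 0 <= lam j.
Proof.
have := energy_ge0 Vfin hharm (eigen_dom j).
rewrite eigen_energy ?eigen_orthonormal ?eqxx ?mulr1//; first exact: eigen_dom.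
by move=> p; exact: eigen_V0.
Qed.

Definition eigen_sum (a : nat -> R) N (x : X) := \sum_(j < N) a j * phi j x.

Lemma eigen_sum_dom a N : dom (eigen_sum a N).
Proof.
by apply: (dom_sum Vfin hharm (index_enum 'I_N) (fun j => a j) (u := fun j => phi j)) => j;
  exact: eigen_dom.
Qed.

Lemma eigen_sum_V0 a N p : V0 p -> eigen_sum a N p = 0.
Proof. by move=> Vp; rewrite /eigen_sum big1// => j _; rewrite eigen_V0// mulr0. Qed.

Lemma eigen_sum_energy a N v : dom v -> (forall p, V0 p -> v p = 0) ->
  E (eigen_sum a N) v = \sum_(j < N) a j * (lam j * \int[mu]_x (phi j x * v x)).
Proof.
move=> dv v0.
rewrite (energy_suml Vfin hharm (index_enum 'I_N) (fun j : 'I_N => a j)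
  (u := fun j : 'I_N => phi j)) => [|j|//]; last exact: eigen_dom.
by apply: eq_bigr => j _; rewrite eigen_energy.
Qed.

Lemma eigen_sum_coef a N (v : borel X -> R) : bounded_measurable v ->
  \int[mu]_x (v x * eigen_sum a N x) = \sum_(j < N) a j * \int[mu]_x (v x * phi j x).
Proof.
move=> bv.
rewrite -(Rint_sum mu (index_enum 'I_N) (fun j : 'I_N => a j)
  (f := fun j : 'I_N => fun x => v x * phi j x)); last first.
  by move=> j; exact: (bounded_measurableM bv (eigen_bounded_measurable j)).
apply: eq_Rintegral => x _ /=; rewrite /eigen_sum mulr_sumr.
by apply: eq_bigr => j _; rewrite mulrCA.
Qed.

Lemma eigen_sum_inner a N j : (j < N)%N -> \int[mu]_x (phi j x * eigen_sum a N x) = a j.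
Proof.
move=> jN; rewrite (eigen_sum_coef _ _ (eigen_bounded_measurable j)).
rewrite (bigD1 (Ordinal jN))//= eigen_orthonormal eqxx mulr1 big1 ?addr0// => i ij.
rewrite eigen_orthonormal; case: eqVneq => [ji|]; last by rewrite mulr0.
by move: ij; rewrite -val_eqE/= ji eqxx.
Qed.

Lemma eigen_sum_mean_square a N :
  \int[mu]_x (eigen_sum a N x ^+ 2) = \sum_(j < N) a j ^+ 2.
Proof.
under eq_Rintegral do rewrite expr2.
rewrite (eigen_sum_coef _ _ (bounded_measurable_dom hX (eigen_sum_dom a N))).
apply: eq_bigr => j _; under eq_Rintegral do rewrite mulrC.
by rewrite eigen_sum_inner// expr2.
Qed.

Lemma eigen_sum_energy_self a N :
  E (eigen_sum a N) (eigen_sum a N) = \sum_(j < N) lam j * a j ^+ 2.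
Proof.
rewrite eigen_sum_energy; [|exact: eigen_sum_dom|by move=> p; exact: eigen_sum_V0].
by apply: eq_bigr => j _; rewrite eigen_sum_inner// mulrCA expr2.
Qed.

Definition kernel_coef (t : R) (y : X) (j : nat) : R := expR (- lam j * t) * phi j y.

(** On finite sums the heat flow is multiplication of coefficients, and
integrals and energies are finite sums as well; every estimate is proved for
these sums, uniformly in [N], before the limit is taken. *)
Definition partial_kernel N t x y : R := eigen_sum (kernel_coef t y) N x.

Lemma partial_kernelC N t x y : partial_kernel N t x y = partial_kernel N t y x.
Proof. by apply: eq_bigr => j _; rewrite /kernel_coef mulrAC. Qed.

Lemma partial_kernel_ge0 N t x : 0 <= partial_kernel N t x x.
Proof.
apply: sumr_ge0 => j _; rewrite /kernel_coef -mulrA mulr_ge0 ?expR_ge0//.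
by rewrite -expr2 sqr_ge0.
Qed.

(** The spectral gain is [lam * expR (- lam * t) <= t^-1], and the second
exponential factor is left for the kernel. *)
Lemma partial_kernel_energy N t y : 0 < t ->
  E (partial_kernel N t ^~ y) (partial_kernel N t ^~ y) <=
  t^-1 * partial_kernel N t y y.
Proof.
move=> t0; rewrite /partial_kernel eigen_sum_energy_self /eigen_sum mulr_sumr.
apply: ler_sum => j _; rewrite /kernel_coef exprMn expr2.
have le1 : lam j * expR (- lam j * t) <= t^-1.
  rewrite -[leRHS]mul1r ler_pdivlMr// mulrAC mulNr expRN ler_pdivrMr ?expR_gt0//.
  by rewrite mul1r; have := expR_ge1Dx (lam j * t); lra.
have e0 : 0 <= expR (- lam j * t) * phi j y ^+ 2.
  by rewrite mulr_ge0 ?expR_ge0 ?sqr_ge0.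
have := ler_wpM2r e0 le1; congr (_ <= _); rewrite ?expr2; ring.
Qed.

Lemma partial_kernel_mean_square N t y : 0 < t ->
  \int[mu]_x (partial_kernel N t x y ^+ 2) <= partial_kernel N t y y.
Proof.
move=> t0; rewrite /partial_kernel eigen_sum_mean_square /eigen_sum.
apply: ler_sum => j _; rewrite /kernel_coef exprMn expr2 -!mulrA -expr2.
rewrite ler_pM2l ?expR_gt0// ler_piMl ?sqr_ge0//.
by rewrite -[leRHS]expR0 ler_expR mulNr oppr_le0 mulr_ge0 ?eigenvalue_ge0 ?ltW.
Qed.

(** The bound of a function by its energy and its mean square, for [p_t(., y)]
at the point [y]. If [q] is the value there, the energy is at most [q / t] and
the mean square at most [q], so that one factor [q] cancels. *)
Lemma diagonal_level k N t y : 0 < t ->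
  partial_kernel N t y y <=
  2 * K * expR (- k%:R) / t + 2 * (d * expR (- k%:R)) `^ (- S).
Proof.
move=> t0; have q0 := partial_kernel_ge0 N t y; set q := partial_kernel N t y y in q0 *.
have [qle0|qgt0] := leP q 0.
  apply: le_trans qle0 _; apply: addr_ge0; last by rewrite mulr_ge0// powR_ge0.
  by rewrite divr_ge0 ?(ltW t0)// mulr_ge0 ?expR_ge0// mulr_ge0// ltW.
have := sqr_le_energy_mean_level hX hpcf hharm J1 hS hmu K0 hK d01 dr k y
  (eigen_sum_dom (kernel_coef t y) N).
rewrite -[eigen_sum _ _ y]/q => h.
rewrite -(ler_pM2r qgt0) -expr2; apply: le_trans h _; rewrite [leRHS]mulrDl.
apply: lerD.
  rewrite -[leRHS]mulrA; apply: ler_wpM2l; last exact: partial_kernel_energy.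
  by rewrite !mulr_ge0 ?expR_ge0// ltW.
rewrite ler_wpM2l ?mulr_ge0 ?powR_ge0//; exact: partial_kernel_mean_square.
Qed.

(** At large times the vanishing of the kernel on the boundary takes the place
of the mean square. *)
Lemma diagonal_dirichlet N t y : 0 < t -> partial_kernel N t y y <= K / t.
Proof.
move=> t0; have q0 := partial_kernel_ge0 N t y.
have [b Vb] := V0_nonempty hX hpcf hconn J1.
have := hK (eigen_sum_dom (kernel_coef t y) N) y b; rewrite (eigen_sum_V0 _ _ Vb) subr0.
have := partial_kernel_energy N y t0; set q := partial_kernel N t y y in q0 *.
rewrite -[eigen_sum _ _ y]/q => h1 h2.
have [qle0|qgt0] := leP q 0; first by apply: le_trans qle0 _; rewrite divr_ge0 ?(ltW K0) ?(ltW t0).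
rewrite -(ler_pM2r qgt0) -expr2; apply: le_trans h2 _; rewrite -mulrA.
by rewrite ler_pM2l.
Qed.

Lemma partial_kernel_osc N t w y z z' : 0 < t ->
  (partial_kernel N t (Fw w z) y - partial_kernel N t (Fw w z') y) ^+ 2 <=
  K * rw w * (t^-1 * partial_kernel N t y y).
Proof.
move=> t0; have du := eigen_sum_dom (kernel_coef t y) N.
have duw : dom (eigen_sum (kernel_coef t y) N \o Fw w).
  by apply: (dom_compFw Vfin hharm) => // j; exact: (ss_cont hX).
apply: le_trans (hK duw z z') _; rewrite -mulrA ler_pM2l//.
apply: le_trans (energy_cell_le hX hpcf hharm w du) _.
rewrite ler_pM2l ?(rword_gt0 hharm)//; exact: partial_kernel_energy.
Qed.

(** Under the heat flow the weighted mean square of a combination of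
eigenfunctions grows at most exponentially: the derivative is minus twice the
energy that the weighted inequality bounds from below. *)
Lemma weighted_evolution (Lam h : R) (g : X -> R) a N t : dom g -> 0 <= t ->
  (forall u, dom u -> - Lam * \int[mu]_x (weighted h g u x ^+ 2) <=
     E u (weighted (2 * h) g u)) ->
  \int[mu]_x (weighted h g (eigen_sum (fun j => expR (- lam j * t) * a j) N) x ^+ 2) <=
  expR (2 * Lam * t) * \int[mu]_x (weighted h g (eigen_sum a N) x ^+ 2).
Proof.
move=> dg t0 hL.
pose W (i j : 'I_N) := \int[mu]_x (phi i x * weighted (2 * h) g (phi j) x).
have dw i : dom (weighted (2 * h) g (phi i)).
  exact: (dom_weighted hX hpcf hharm _ dg (eigen_dom i)).
have weighted_comb (b : nat -> R) z x :
    weighted z g (eigen_sum b N) x = \sum_(j < N) b j * weighted z g (phi j) x.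
  by rewrite /weighted /eigen_sum mulr_sumr; apply: eq_bigr => j _; rewrite mulrCA.
have bmW (i j : 'I_N) : bounded_measurable (fun x : borel X => phi i x * weighted (2 * h) g (phi j) x).
  by apply: bounded_measurableM; [exact: eigen_bounded_measurable|
     exact: (bounded_measurable_dom hX (dw j))].
have pairing (b : nat -> R) (i : 'I_N) :
    \int[mu]_x (phi i x * weighted (2 * h) g (eigen_sum b N) x) = \sum_(j < N) b j * W i j.
  rewrite -(Rint_sum mu (index_enum 'I_N) (fun j : 'I_N => b j)
    (f := fun (j : 'I_N) x => phi i x * weighted (2 * h) g (phi j) x))//.
  apply: eq_Rintegral => x _ /=; rewrite weighted_comb mulr_sumr.
  by apply: eq_bigr => j _; rewrite mulrCA.
have norm_comb (b : nat -> R) : \int[mu]_x (weighted h g (eigen_sum b N) x ^+ 2) =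
    \sum_(i < N) b i * \sum_(j < N) b j * W i j.
  under eq_bigr do rewrite -pairing.
  rewrite -(Rint_sum mu (index_enum 'I_N) (fun i : 'I_N => b i)
    (f := fun (i : 'I_N) x => phi i x * weighted (2 * h) g (eigen_sum b N) x)); last first.
    move=> i; apply: bounded_measurableM; first exact: eigen_bounded_measurable.
    apply: (bounded_measurable_dom hX (c := c) (r := r)).
    exact: (dom_weighted hX hpcf hharm _ dg (eigen_sum_dom b N)).
  apply: eq_Rintegral => x _ /=.
  have -> : weighted h g (eigen_sum b N) x ^+ 2 =
      eigen_sum b N x * weighted (2 * h) g (eigen_sum b N) x.
    rewrite /weighted exprMn expr2 -expRD expr2 mulrCA mulrA mulrC.
    rewrite [eigen_sum b N x * expR _]mulrC; congr (_ * (expR _ * _)).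
    by rewrite mulr_natl mulr2n mulrDl.
  by rewrite {1}/eigen_sum mulr_suml; apply: eq_bigr => i _; rewrite mulrA.
pose I := ('I_N * 'I_N)%type.
pose m (p : I) := lam p.1 + lam p.2 + 2 * Lam.
pose A (p : I) := a p.1 * a p.2 * W p.1 p.2.
have Wsym i j : W i j = W j i.
  by apply: eq_Rintegral => x _ /=; rewrite /weighted; ring.
have double (b : nat -> R) (G : 'I_N -> 'I_N -> R) :
    \sum_(i < N) b i * \sum_(j < N) b j * G i j =
    \sum_(p : I) b p.1 * b p.2 * G p.1 p.2.
  rewrite [RHS](eq_bigr (fun p : I => (fun i j : 'I_N => b i * b j * G i j) p.1 p.2))//.
  rewrite -(pair_bigA _ (fun i j : 'I_N => b i * b j * G i j))/=.
  by apply: eq_bigr => i _; rewrite mulr_sumr; apply: eq_bigr => j _; rewrite mulrA.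
pose b (s : R) j := expR (- lam j * s) * a j.
have expm s (p : I) : expR (- (m p * s)) =
    expR (- lam p.1 * s) * expR (- lam p.2 * s) * expR (- (2 * Lam * s)).
  by rewrite -!expRD; congr expR; rewrite /m; ring.
have decay := @exp_sum_le R I (index_enum I) A m t t0.
rewrite (norm_comb (b t)) (norm_comb a) (double (b t)) (double a).
rewrite -[X in X <= _](mulVKf (lt0r_neq0 (expR_gt0 (2 * Lam * t)))).
rewrite ler_pM2l ?expR_gt0// -expRN mulr_sumr.
apply: le_trans (decay _).
  rewrite le_eqVlt; apply/orP; left; apply/eqP; apply: eq_bigr => p _.
  by rewrite /A /b expm; ring.
move=> s.
have := hL _ (eigen_sum_dom (b s) N).
rewrite norm_comb double eigen_sum_energy; last 2 first.
- exact: (dom_weighted hX hpcf hharm _ dg (eigen_sum_dom _ N)).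
- by move=> p Vp; rewrite /weighted eigen_sum_V0// mulr0.
under [leRHS]eq_bigr do rewrite pairing.
have -> : \sum_(j < N) b s j * (lam j * \sum_(j0 < N) b s j0 * W j j0) =
    \sum_(p : I) b s p.1 * b s p.2 * (lam p.1 * W p.1 p.2).
  rewrite -(double (b s) (fun i j => lam i * W i j)); apply: eq_bigr => i _.
  by congr (_ * _); rewrite mulr_sumr; apply: eq_bigr => j _; rewrite mulrCA.
set S1 := \sum_(p : I) b s p.1 * b s p.2 * W p.1 p.2.
set S2 := \sum_(p : I) b s p.1 * b s p.2 * (lam p.1 * W p.1 p.2).
have S2sym : S2 = \sum_(p : I) b s p.1 * b s p.2 * (lam p.2 * W p.1 p.2).
  rewrite /S2 (reindex (fun p : I => (p.2, p.1)))/=; last first.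
    by exists (fun p : I => (p.2, p.1)) => -[].
  by apply: eq_bigr => p _; rewrite Wsym [b s p.2 * _]mulrC.
have -> : \sum_(p : I) m p * A p * expR (- (m p * s)) =
    expR (- (2 * Lam * s)) * (2 * S2 + 2 * Lam * S1).
  have -> : 2 * S2 + 2 * Lam * S1 = S2 + S2 + 2 * Lam * S1 by ring.
  rewrite {2}S2sym /S2 /S1 -big_split/= mulr_sumr -big_split/= mulr_sumr.
  by apply: eq_bigr => p _; rewrite expm /A /m /b; ring.
by move=> h1; rewrite mulr_ge0 ?expR_ge0//; lra.
Qed.

End Spectral.

(** * From weighted mean squares to pointwise bounds *)

Section Pointwise.
Context (R : realType) (X : pmetricType R) (J : nat).
Variables (F : 'I_J -> X -> X) (pi : shift_space J -> X).
Variables (c : X -> X -> R) (r : 'I_J -> R) (S : R) (mu : probability (borel X) R).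
Local Notation V0 := (V0 F pi).
Hypotheses (hX : self_similar_set F pi) (hpcf : post_critically_finite F pi).
Hypotheses (hharm : regular_harmonic_structure F V0 c r).
Hypothesis hmu : self_similar_measure F r S mu.

Local Notation E := (energy F V0 c r).
Local Notation dom := (dom_energy F V0 c r).
Local Notation Fw := (Fword F).
Local Notation rw := (rword r).

Variable K : R.
Hypotheses (K0 : 0 < K)
  (hK : forall u, dom u -> forall x y, (u x - u y) ^+ 2 <= K * E u u).

Variables (phi : nat -> X -> R) (lam : nat -> R).
Hypothesis hphi : dirichlet_eigenbasis F V0 c r mu phi lam.

Variables (t Q : R).
Hypothesis t0 : 0 < t.
Hypothesis hQ : forall N z, partial_kernel phi lam N t z z <= Q.
Local Notation pk := (partial_kernel phi lam).

(** The two diagonal series have nonnegative terms and bounded partial sums, and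
they dominate the series at [x] and [y]. *)
Lemma heat_kernel_cvg x y : pk N t x y @[N --> \oo] --> heat_kernel phi lam t x y.
Proof.
pose a z j := expR (- lam j * t) * phi j z * phi j z.
have a0 z j : 0 <= a z j by rewrite /a -mulrA mulr_ge0 ?expR_ge0// -expr2 sqr_ge0.
have pkE z z' N : pk N t z z' =
    series (fun j => expR (- lam j * t) * phi j z * phi j z') N.
  rewrite /series/= big_mkord /partial_kernel /eigen_sum.
  by apply: eq_bigr => j _; rewrite /kernel_coef mulrAC.
have Q0 : 0 <= Q by apply: le_trans (hQ 0 x); rewrite pkE /series/= big_geq.
have cva z : cvgn (series (a z)).
  apply: nondecreasing_is_cvgn; first by apply: nondecreasing_series => j _ _.
  by exists Q => _ [N _ <-]; rewrite /= -pkE.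
have -> : (fun N => pk N t x y) =
    series (fun j => expR (- lam j * t) * phi j x * phi j y).
  by apply/funext => N; rewrite pkE.
suff : cvgn (series (fun j => expR (- lam j * t) * phi j x * phi j y)) by [].
apply: normed_cvg.
apply: (@series_le_cvg _ _ (a x + a y)) => [j|j|j|].
- exact: normr_ge0.
- by rewrite addr_ge0.
- rewrite /= -mulrA normrM ger0_norm ?expR_ge0// /a -[X in _ <= X]/(a x j + a y j).
  rewrite /a -!mulrA -mulrDr ler_pM2l ?expR_gt0// normrM -!expr2.
  rewrite -(real_normK (num_real (phi j x))) -(real_normK (num_real (phi j y))).
  by have := sqr_ge0 (`|phi j x| - `|phi j y|); have := sqr_ge0 (`|phi j x|);
     have := sqr_ge0 (`|phi j y|); nra.
- by rewrite seriesD; apply: is_cvgD.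
Qed.

Lemma heat_kernel_le x y M : (\forall N \near \oo, `|pk N t x y| <= M) ->
  `|heat_kernel phi lam t x y| <= M.
Proof.
move=> le.
have cv : `|pk N t x y| @[N --> \oo] --> `|heat_kernel phi lam t x y|.
  by apply: cvg_norm; exact: heat_kernel_cvg.
by have <- := cvg_lim (@Rhausdorff R) cv; apply: limr_le => //; exact: cvgP cv.
Qed.

Lemma indicator_average (A : set (borel X)) (f : borel X -> R) a e :
  measurable A -> bounded_measurable f -> (forall z, A z -> `|a - f z| <= e) ->
  `|a * \int[mu]_z \1_A z - \int[mu]_z (\1_A z * f z)| <= e * \int[mu]_z \1_A z.
Proof.
move=> mA bf close.
have bA := bounded_measurable_indic mA : bounded_measurable (\1_A : borel X -> R).
have bAf := bounded_measurableM bA bf.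
have up : \int[mu]_z (\1_A z * f z) <= (a + e) * \int[mu]_z \1_A z.
  have := Rint_lin mu (a + e) 0 bA bA; rewrite mul0r addr0 => <-.
  apply: Rint_le => //; first exact: bounded_measurable_lin.
  move=> z; rewrite mul0r addr0 indicE; case: (boolP (z \in A)) => [/set_mem Az|_].
    by have := close z Az; rewrite ler_norml => /andP[+ _]; rewrite mul1r mulr1; lra.
  by rewrite mul0r mulr0.
have lo : (a - e) * \int[mu]_z \1_A z <= \int[mu]_z (\1_A z * f z).
  have := Rint_lin mu (a - e) 0 bA bA; rewrite mul0r addr0 => <-.
  apply: Rint_le => //; first exact: bounded_measurable_lin.
  move=> z; rewrite mul0r addr0 indicE; case: (boolP (z \in A)) => [/set_mem Az|_].
    by have := close z Az; rewrite ler_norml => /andP[_ +]; rewrite mul1r mulr1; lra.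
  by rewrite mul0r mulr0.
by rewrite ler_norml; apply/andP; split; move: up lo; lra.
Qed.

(** The weight is at most [expR al] on the cell of [y] and at least [expR be] on
the cell of [x], so that heat started in the first cell reaches the second one
in the mean only with a factor [expR (al - be)]; this mean differs from the value
of the kernel by its oscillation on the two cells. *)
Lemma partial_kernel_cells (Lam h : R) (g : X -> R) v w x y (al be rho : R) :
  dom g ->
  (forall u, dom u -> - Lam * \int[mu]_z (weighted h g u z ^+ 2) <=
     E u (weighted (2 * h) g u)) ->
  range (Fw v) y -> range (Fw w) x ->
  (forall z, range (Fw v) z -> h * g z <= al) ->
  (forall z, range (Fw w) z -> be <= h * g z) ->
  rw v <= rho -> rw w <= rho ->
  \forall N \near \oo, `|pk N t x y| <=
    2 * Num.sqrt (K * rho * (t^-1 * Q)) +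
    expR (al - be) * (2 * expR (2 * Lam * t) * rw w `^ (- S) + rw v `^ (- S)).
Proof.
move=> dg hL vy wx val wbe vrho wrho.
set A := range (Fw v); set B := range (Fw w).
have cF j : continuous (F j) by exact: (ss_cont hX).
have rgt0 j : 0 < r j by exact: (ratio_gt0 hharm).
have mA : measurable (A : set (borel X)) by apply: closed_borel; exact: (cell_closed hX).
have mB : measurable (B : set (borel X)) by apply: closed_borel; exact: (cell_closed hX).
have bA := bounded_measurable_indic mA : bounded_measurable (\1_A : borel X -> R).
have bB := bounded_measurable_indic mB : bounded_measurable (\1_B : borel X -> R).
set mAr := \int[mu]_z \1_A z; set mBr := \int[mu]_z \1_B z.
have mA0 : rw v `^ S <= mAr by exact: (cell_measure_ge hX rgt0 hmu).
have mB0 : rw w `^ S <= mBr by exact: (cell_measure_ge hX rgt0 hmu).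
have rv0 : 0 < rw v `^ S by rewrite powR_gt0 ?(rword_gt0 hharm).
have rw0 : 0 < rw w `^ S by rewrite powR_gt0 ?(rword_gt0 hharm).
have mAgt : 0 < mAr by exact: lt_le_trans mA0.
have mBgt : 0 < mBr by exact: lt_le_trans mB0.
pose f j := \int[mu]_z (\1_A z * phi j z).
pose u0 N := eigen_sum phi f N.
pose ut N := eigen_sum phi (fun j => expR (- lam j * t) * f j) N.
have bu0 N : bounded_measurable (u0 N) by exact: (bounded_measurable_dom hX (eigen_sum_dom hpcf hharm hphi f N)).
have dut N : dom (ut N) by exact: (eigen_sum_dom hpcf hharm hphi).
have but N : bounded_measurable (ut N) by exact: (bounded_measurable_dom hX (dut N)).
have [_ [G0 hG0]] := bounded_measurable_dom hX dg.
pose G := `|h| * G0.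
have hG z : h * g z <= G.
  by apply: le_trans (ler_norm _) _; rewrite normrM ler_wpM2l.
pose e1 := expR (2 * al) * mAr * expR (- (2 * G)).
have e10 : 0 < e1 by rewrite !mulr_gt0 ?expR_gt0.
have conv : \forall N \near \oo, \int[mu]_z ((\1_A z - u0 N z) ^+ 2) <= e1.
  have [[_ _ /(_ _ (bounded_measurable_Lfun2 mu bA)) cv] _ _] := hphi.
  by move/cvgr_le : cv; exact.
near=> N.
have eN : \int[mu]_z ((\1_A z - u0 N z) ^+ 2) <= e1 by near: N.
have bdiff : bounded_measurable (fun z : borel X => (\1_A z - u0 N z) ^+ 2).
  apply: bounded_measurable_sqr.
  by have := bounded_measurable_lin 1 (-1) bA (bu0 N);
     under eq_fun do rewrite mul1r mulN1r.
have bw (u : X -> R) : dom u ->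
    bounded_measurable (fun z : borel X => weighted h g u z ^+ 2).
  move=> du; apply: bounded_measurable_sqr.
  exact: (bounded_measurable_dom hX (dom_weighted hX hpcf hharm h dg du)).
have start : \int[mu]_z (weighted h g (u0 N) z ^+ 2) <= 4 * expR (2 * al) * mAr.
  apply: (@le_trans _ _ (2 * expR (2 * al) * mAr +
      2 * expR (2 * G) * \int[mu]_z ((\1_A z - u0 N z) ^+ 2))); last first.
    have : 2 * expR (2 * G) * \int[mu]_z ((\1_A z - u0 N z) ^+ 2) <=
        2 * expR (2 * G) * e1 by rewrite ler_wpM2l// mulr_ge0// expR_ge0.
    have -> : 2 * expR (2 * G) * e1 = 2 * expR (2 * al) * mAr.
      by rewrite /e1 expRN; field; rewrite gt_eqF// expR_gt0.
    by lra.
  rewrite -(Rint_lin mu _ _ bA bdiff).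
  apply: Rint_le; first by apply: bw; exact: (eigen_sum_dom hpcf hharm hphi).
    exact: bounded_measurable_lin.
  move=> z; rewrite /weighted exprMn.
  have -> : expR (h * g z) ^+ 2 = expR (2 * (h * g z)).
    by rewrite expr2 -expRD; congr expR; ring.
  have ez : expR (2 * (h * g z)) * (\1_A z - u0 N z) ^+ 2 <=
      expR (2 * G) * (\1_A z - u0 N z) ^+ 2.
    by rewrite ler_wpM2r ?sqr_ge0// ler_expR ler_pM2l.
  have eA : expR (2 * (h * g z)) * \1_A z <= expR (2 * al) * \1_A z.
    rewrite indicE; case: (boolP (z \in A)) => [/set_mem Az|_]; last by rewrite !mulr0.
    by rewrite !mulr1 ler_expR ler_pM2l// val.
  have sq : u0 N z ^+ 2 <= 2 * \1_A z + 2 * (\1_A z - u0 N z) ^+ 2.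
    have : \1_A z ^+ 2 = \1_A z :> R by rewrite indicE; case: (_ \in _); rewrite ?expr1n ?expr0n.
    by have := sqr_ge0 (\1_A z + (\1_A z - u0 N z)); nra.
  by have := ler_wpM2l (expR_ge0 (2 * (h * g z))) sq; lra.
have evol : \int[mu]_z (weighted h g (ut N) z ^+ 2) <=
    expR (2 * Lam * t) * (4 * expR (2 * al) * mAr).
  apply: le_trans (weighted_evolution hX hpcf hharm hphi f N dg (ltW t0) hL) _.
  by rewrite ler_pM2l ?expR_gt0.
have reach : `|\int[mu]_z (\1_B z * ut N z)| <=
    expR (al - be) * (2 * expR (2 * Lam * t) * mAr + 2^-1 * mBr).
  pose a1 := 2^-1 * expR (- (al + be)); pose a2 := 2^-1 * expR (al - be).
  have total : a1 * \int[mu]_z (weighted h g (ut N) z ^+ 2) + a2 * mBr <=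
      expR (al - be) * (2 * expR (2 * Lam * t) * mAr + 2^-1 * mBr).
    have a10 : 0 <= a1 by rewrite mulr_ge0// expR_ge0.
    have := ler_wpM2l a10 evol.
    have -> : a1 * (expR (2 * Lam * t) * (4 * expR (2 * al) * mAr)) =
        expR (al - be) * (2 * expR (2 * Lam * t) * mAr).
      have -> : expR (al - be) = expR (- (al + be)) * expR (2 * al).
        by rewrite -expRD; congr expR; ring.
      by rewrite /a1; field.
    by rewrite /a2 mulrDr; lra.
  have bound (s : R) : s ^+ 2 = 1 -> s * \int[mu]_z (\1_B z * ut N z) <=
      a1 * \int[mu]_z (weighted h g (ut N) z ^+ 2) + a2 * mBr.
    move=> s1.
    have bBu := bounded_measurableM bB (but N).
    have := Rint_lin mu s 0 bBu bBu; rewrite mul0r addr0 => <-.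
    rewrite -(Rint_lin mu _ _ (bw _ (dut N)) bB).
    apply: Rint_le; [exact: bounded_measurable_lin| |].
      by apply: bounded_measurable_lin => //; exact: bw.
    move=> z; rewrite mul0r addr0 indicE.
    case: (boolP (z \in B)) => [/set_mem Bz|_]; last first.
      by rewrite mul0r !mulr0 addr0 mulr_ge0 ?sqr_ge0// mulr_ge0// expR_ge0.
    rewrite mul1r mulr1 /weighted; set e := expR (h * g z).
    have ebe : expR be <= e by rewrite ler_expR wbe.
    have e0 : 0 < e by exact: expR_gt0.
    have -> : a1 = 2^-1 * expR (- al) * (expR be)^-1.
      by rewrite /a1 opprD expRD [expR (- be)]expRN mulrA.
    have -> : a2 = 2^-1 * expR al * (expR be)^-1.
      by rewrite /a2 expRD [expR (- be)]expRN mulrA.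
    have al0 := expR_gt0 al; have be0 := expR_gt0 be.
    rewrite expRN; set p := expR al in al0 *; set q := expR be in be0 ebe *.
    set a := ut N z.
    rewrite -(ler_pM2r (mulr_gt0 al0 be0)).
    have -> : (2^-1 * p^-1 * q^-1 * (e * a) ^+ 2 + 2^-1 * p * q^-1) * (p * q) =
        2^-1 * ((e * a) ^+ 2 + p ^+ 2).
      by field; apply/andP; rewrite !gt_eqF.
    have h1 : s * a * (p * q) <= `|a| * p * q.
      rewrite !mulrA ler_pM2r// ler_pM2r//; apply: le_trans (ler_norm _) _.
      rewrite normrM (_ : `|s| = 1) ?mul1r//; apply/eqP.
      by rewrite -(@eqrXn2 _ 2%N)// real_normK ?num_real// s1 expr1n.
    have h2 : `|a| * p * q <= `|a| * p * e by rewrite ler_wpM2l// mulr_ge0// ltW.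
    apply: le_trans h1 _; apply: le_trans h2 _.
    have -> : (e * a) ^+ 2 = (e * `|a|) ^+ 2 by rewrite !exprMn real_normK ?num_real.
    by have := sqr_ge0 (e * `|a| - p); nra.
  have := bound 1 (expr1n _ _); have := bound (-1) (etrans (sqrrN 1) (expr1n _ 2)).
  rewrite mul1r mulN1r ler_norml => h1 h2; apply/andP; split; last exact: le_trans h2 total.
  by rewrite lerNl; exact: le_trans h1 total.
set de := Num.sqrt (K * rho * (t^-1 * Q)).
have osc1 o z z' y' : rw o <= rho -> range (Fw o) z -> range (Fw o) z' ->
    `|pk N t z y' - pk N t z' y'| <= de.
  move=> orho [a _ <-] [b _ <-]; rewrite -sqrtr_sqr; apply: ler_wsqrtr.
  apply: le_trans (partial_kernel_osc hX hpcf hharm K0 hK hphi N o y' a b t0) _.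
  apply: ler_pM.
  - by rewrite mulr_ge0 ?(ltW K0)// ltW// (rword_gt0 hharm).
  - by rewrite mulr_ge0 ?invr_ge0 ?(ltW t0)// partial_kernel_ge0.
  - by rewrite ler_pM2l.
  - by rewrite ler_pM2l ?invr_gt0.
have osc z z' : B z -> A z' -> `|pk N t x y - pk N t z z'| <= 2 * de.
  move=> Bz Az'; rewrite -(subrKA (pk N t z y)); apply: le_trans (ler_normD _ _) _.
  rewrite mulr_natl mulr2n; apply: lerD; first exact: (osc1 w).
  by rewrite ![pk N t z _]partial_kernelC; exact: (osc1 v).
have ave1 z : B z -> `|pk N t x y * mAr - ut N z| <= 2 * de * mAr.
  move=> Bz.
  have -> : ut N z = \int[mu]_z' (\1_A z' * pk N t z z').
    under eq_Rintegral do rewrite partial_kernelC.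
    rewrite (eigen_sum_coef hX hphi _ _ bA); apply: eq_bigr => j _.
    by rewrite /kernel_coef mulrAC.
  apply: indicator_average => //.
    rewrite (_ : pk N t z = pk N t ^~ z); last first.
      by apply/funext => z'; rewrite partial_kernelC.
    exact: (bounded_measurable_dom hX (eigen_sum_dom hpcf hharm hphi _ N)).
  by move=> z' Az'; exact: osc.
have ave2 := indicator_average mB (but N) ave1.
have AB0 : 0 < mAr * mBr by rewrite mulr_gt0.
have main : `|pk N t x y| * (mAr * mBr) <= 2 * de * (mAr * mBr) +
    expR (al - be) * (2 * expR (2 * Lam * t) * mAr + 2^-1 * mBr).
  rewrite -[X in _ * X <= _](gtr0_norm AB0) -normrM mulrA.
  rewrite -[X in `|X|](subrK (\int[mu]_z (\1_B z * ut N z))).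
  apply: le_trans (ler_normD _ _) _; apply: lerD => //.
  by rewrite mulrA.
rewrite -(ler_pM2r AB0); apply: le_trans main _; rewrite [leRHS]mulrDl lerD2l.
have unit (p q : R) : 0 < p `^ S -> p `^ S <= q -> 1 <= p `^ (- S) * q.
  by move=> p0 pq; rewrite powRN mulrC ler_pdivlMr ?mul1r.
have vA := unit _ _ rv0 mA0; have wB := unit _ _ rw0 mB0.
rewrite -[leRHS]mulrA ler_pM2l ?expR_gt0// [leRHS]mulrDl; apply: lerD.
  have -> : 2 * expR (2 * Lam * t) * rw w `^ (- S) * (mAr * mBr) =
      2 * expR (2 * Lam * t) * mAr * (rw w `^ (- S) * mBr) by ring.
  by rewrite ler_peMr// mulr_ge0 ?(ltW mAgt)// mulr_ge0// expR_ge0.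
have -> : rw v `^ (- S) * (mAr * mBr) = mBr * (rw v `^ (- S) * mAr) by ring.
have := ler_peMr (ltW mBgt) vA; apply: le_trans.
by rewrite ger_pMl// invf_le1// ler1n.
Unshelve. all: by end_near. Qed.

End Pointwise.

(** * The graph distance as a weight *)

Section Distance.
Context (R : realType) (X : pmetricType R) (J : nat).
Variables (F : 'I_J -> X -> X) (B : set X) (r : 'I_J -> R) (k : nat).

Lemma edge_sym x y : edge F B r k x y -> edge F B r k y x.
Proof. by move=> [w Tw [wx wy]]; exists w. Qed.

Lemma walk_cons n x y z : edge F B r k x y -> walk F B r k n y z ->
  walk F B r k n.+1 x z.
Proof.
move=> exy [p [p0 pn pe]].
exists (fun i => if i is i'.+1 then p i' else x); split=> // -[_|i ilt].
  by rewrite p0.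
exact: pe.
Qed.

Lemma cell_dist_ge0 x y : 0 <= cell_dist F B r k x y.
Proof.
rewrite /cell_dist; set A := [set n%:R | n in _].
have [->|/set0P A0] := eqVneq A set0; first by rewrite inf0.
by apply: lb_le_inf => // _ [n _ <-].
Qed.

(** The distance to [y], cut off at the distance [D] from [x] to [y]: data of a
spline must be bounded. *)
Lemma distance_function x y : let D := cell_dist F B r k x y in
  exists a : X -> R, [/\ forall z, 0 <= a z <= D,
    forall z z', edge F B r k z z' -> (a z - a z') ^+ 2 <= 1,
    forall z, anchors F B r k x z -> a z = D &
    forall z, anchors F B r k y z -> a z = 0].
Proof.
move=> D; have D0 : 0 <= D := cell_dist_ge0 x y.
pose Z z : set R := [set s | s = D \/ exists n b,
  [/\ s = n%:R, anchors F B r k y b & walk F B r k n z b]].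
pose a z := inf (Z z).
have ZD z : Z z D by left.
have Zlb z : lbound (Z z) 0 by move=> s [->//|[n [b [-> _ _]]]].
have hasl z : has_lbound (Z z) by exists 0.
have a_le z s : Z z s -> a z <= s by move=> Zs; exact: ge_inf.
have a_ge z s : lbound (Z z) s -> s <= a z.
  by move=> ls; apply: lb_le_inf => //; exists D.
have step z z' : edge F B r k z z' -> a z - 1 <= a z'.
  move=> ezz'; apply: a_ge => s [->|[n [b [-> yb wb]]]].
    by have := a_le z D (ZD z); lra.
  rewrite lerBlDr; apply: le_trans (a_le z n.+1%:R _) _; last by rewrite -natr1.
  by right; exists n.+1, b; split=> //; exact: walk_cons ezz' wb.
exists a; split.
- by move=> z; rewrite a_ge//= a_le.
- move=> z z' ezz'; have := step _ _ ezz'; have := step _ _ (edge_sym ezz').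
  move=> h1 h2; have h3 : -1 <= a z - a z' by lra.
  have h4 : a z - a z' <= 1 by lra.
  by nra.
- move=> z xz; apply/eqP; rewrite eq_le a_le//=; apply: a_ge => s [->//|].
  move=> [n [b [-> yb wb]]]; rewrite /D /cell_dist; apply: ge_inf.
    by exists 0 => _ [n' _ <-].
  by exists n => //; exists z, b.
- move=> z yz; apply/eqP; rewrite eq_le a_ge// andbT; apply: a_le.
  right; exists 0%N, z; split=> //; exists (fun=> z); split=> //.
Qed.

End Distance.

(** * The heat kernel estimate *)

Section Estimate.
Context (R : realType) (X : pmetricType R) (J : nat).
Variables (F : 'I_J -> X -> X) (pi : shift_space J -> X).
Variables (c : X -> X -> R) (r : 'I_J -> R) (S : R) (mu : probability (borel X) R).
Local Notation V0 := (V0 F pi).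
Hypotheses (hX : self_similar_set F pi) (hpcf : post_critically_finite F pi).
Hypotheses (hconn : connected (~` V0)).
Hypotheses (hharm : regular_harmonic_structure F V0 c r) (J1 : (1 < J)%N).
Hypotheses (hS : \sum_(j < J) r j `^ S = 1) (hmu : self_similar_measure F r S mu).

Local Notation E0 := (energy0 V0 c).
Local Notation E := (energy F V0 c r).
Local Notation dom := (dom_energy F V0 c r).
Local Notation Fw := (Fword F).
Local Notation rw := (rword r).
Let S0 : 0 < S := dimension_gt0 hharm J1 hS.

Variables (K d : R).
Hypotheses (K0 : 0 < K)
  (hK : forall u, dom u -> forall x y, (u x - u y) ^+ 2 <= K * E u u).
Hypotheses (d01 : 0 < d <= 1) (dr : forall j, d <= r j).

(** Distances at level zero: the graph is complete. *)
Lemma cell_dist_level0 x y : cell_dist F V0 r 0 x y <= 1.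
Proof.
have [b0 Vb0] := V0_nonempty hX hpcf hconn J1.
have T0 : Theta r 0 [::].
  by split=> [|v j]; [rewrite rword_nil oppr0 expR0|case: v].
have T0E w : Theta r 0 w -> w = [::].
  case/lastP: w => [//|w j] [_ /(_ w j erefl)].
  by rewrite oppr0 expR0 ltNge (rword_le1 hharm).
have near z : exists2 b, anchors F V0 r 0 z b & V0 b.
  have [[w Tw [p Vp wp]]|nv] := pselect (vertices F V0 (Theta r 0) z).
    exists z; last by rewrite -wp (T0E w Tw).
    by left; split=> //; exists w => //; exists p.
  exists b0 => //; right; split=> //; exists [::] => //; split; first by exists z.
  by exists b0.
have [a xa Va] := near x; have [b yb Vb] := near y.
apply: ge_inf; first by exists 0 => _ [n' _ <-].
exists 1%N => //; exists a, b; split=> //.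
exists (fun i => if i is 0%N then a else b); split=> // -[_|//].
by exists [::] => //; split; [exists a|exists b].
Qed.

Lemma powR_expR (a b : R) : expR a `^ b = expR (b * a).
Proof. by rewrite /powR gt_eqF ?expR_gt0// expRK. Qed.

Section Basis.
Variables (phi : nat -> X -> R) (lam : nat -> R).
Hypothesis hphi : dirichlet_eigenbasis F V0 c r mu phi lam.
Local Notation pk := (partial_kernel phi lam).

(** Times are parametrized by the level [tau] of the cells of matching size, a
real number. If it is positive, the bound at its integral part is taken, which
loses a constant; if not, the cells would be larger than [X] and the Dirichlet
condition gives the bound. *)
Lemma diagonal_bound N tau z :
  pk N (expR (- ((S + 1) * tau))) z z <=
  (K + 2 * K * expR 1 + 2 * d `^ (- S)) * expR (S * tau).
Proof.
have K0' := ltW K0; have d0 : 0 <= d by case/andP: d01 => /ltW.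
have e0 := expR_ge0 (S * tau); have p0 := powR_ge0 d (- S); have e1 := expR_ge0 (1 : R).
have [tau0|/ltW tau0] := leP tau 0.
  apply: le_trans (diagonal_dirichlet hX hpcf hconn hharm J1 K0 hK hphi N z (expR_gt0 _)) _.
  rewrite -expRN opprK; apply: (@le_trans _ _ (K * expR (S * tau))).
    by rewrite ler_pM2l// ler_expR mulrDl mul1r gerDl.
  by rewrite ler_wpM2r// -addrA lerDl addr_ge0// mulr_ge0// mulr_ge0.
pose k := Num.truncn tau.
have /andP[k1 k2] := truncn_itv tau0.
apply: le_trans (diagonal_level hX hpcf hharm J1 hS hmu K0 hK d01 dr hphi k N z (expR_gt0 _)) _.
rewrite -expRN opprK -mulrA -expRD powRM ?expR_ge0// powR_expR.
have -> : (K + 2 * K * expR 1 + 2 * d `^ (- S)) * expR (S * tau) =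
    K * expR (S * tau) + (2 * K * expR (1 + S * tau) + 2 * (d `^ (- S) * expR (S * tau))).
  by rewrite expRD; ring.
rewrite -[leLHS]add0r; apply: lerD; first by rewrite mulr_ge0.
apply: lerD.
  rewrite ler_wpM2l ?mulr_ge0// ler_expR.
  by move: k2; rewrite -natr1 -/k; lra.
rewrite ler_pM2l// ler_wpM2l// ler_expR.
by rewrite mulrN mulNr opprK ler_pM2l.
Qed.

(** This is the arithmetic-geometric mean inequality, term by term. *)
Lemma heat_kernel_diagonal t Q x y : (forall N z, pk N t z z <= Q) ->
  `|heat_kernel phi lam t x y| <= Q.
Proof.
move=> hQ; apply: (heat_kernel_le hQ); apply: nearW => N.
have half : `|pk N t x y| <= 2^-1 * (pk N t x x + pk N t y y).
  rewrite /partial_kernel /eigen_sum -big_split mulr_sumr /=.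
  apply: le_trans (ler_norm_sum _ _ _) _; apply: ler_sum => j _.
  rewrite /kernel_coef -!mulrA -mulrDr normrM (ger0_norm (expR_ge0 _)) mulrCA.
  rewrite ler_pM2l ?expR_gt0// normrM.
  have hx : phi j x * phi j x = `|phi j x| ^+ 2 by rewrite real_normK ?num_real.
  have hy : phi j y * phi j y = `|phi j y| ^+ 2 by rewrite real_normK ?num_real.
  rewrite hx hy; have := sqr_ge0 (`|phi j x| - `|phi j y|).
  by rewrite sqrrB mulr2n; lra.
by apply: le_trans half _; have := hQ N x; have := hQ N y; lra.
Qed.

Variable eps : R.
Hypotheses (eps0 : 0 < eps)
  (epsM : 6 * eps ^+ 2 * K * total_conductance F pi c <= 1).

(** The spline of the distance to [y] is the logarithm of the weight. On the
cell of level [k] that contains [x], or [y], the weight varies by a bounded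
factor only; the smaller cells of level [k + m] serve for averaging. *)
Lemma off_diagonal k m t Q x y : 0 < t ->
  (forall N z, pk N t z z <= Q) ->
  `|heat_kernel phi lam t x y| <=
    2 * Num.sqrt (K * expR (- (k + m)%:R) * (t^-1 * Q)) +
    expR (2 - eps * cell_dist F V0 r k x y) *
    ((2 * expR (2 * (K^-1 * (d * expR (- k%:R)) `^ (- (S + 1))) * t) + 1) *
     (d ^+ 2 * expR (- (k + m)%:R)) `^ (- S)).
Proof.
move=> t0 hQ; set D := cell_dist F V0 r k x y.
have [a [aD aLip ax ay]] := distance_function F V0 r k x y; rewrite -/D in aD ax.
have [g [dg ga gE]] := spline hX hpcf hconn hharm J1 k aD.
have gM w : Theta r k w -> E (g \o Fw w) (g \o Fw w) <= total_conductance F pi c.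
  move=> Tw; rewrite gE// -[leRHS]mulr1; apply: (energy0_le_total hpcf hharm).
  move=> p q Vp Vq; apply: aLip; exists w => //.
have hL := davies hX hpcf hharm J1 hS hmu K0 hK d01 dr dg gM epsM.
have cF j : continuous (F j) by exact: (ss_cont hX).
have Vfin := V0_finite hpcf.
have osc w z z' : Theta r k w -> `|eps * g (Fw w z) - eps * g (Fw w z')| <= 2^-1.
  move=> Tw; rewrite -mulrBr -ler_sqr ?nnegrE ?invr_ge0// real_normK ?num_real// exprMn.
  have dgw : dom (g \o Fw w) by exact: (dom_compFw Vfin hharm).
  have h := hK dgw z z'.
  apply: (@le_trans _ _ (eps ^+ 2 * (K * total_conductance F pi c))).
    rewrite ler_wpM2l ?sqr_ge0//; apply: le_trans h _.
    by rewrite ler_pM2l// gM.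
  by move: epsM; lra.
have [b0 Vb0] := V0_nonempty hX hpcf hconn J1.
have value z (e : R) : (forall z', anchors F V0 r k z z' -> a z' = e) ->
    `|eps * g z - eps * e| <= 2^-1.
  move=> hz; have [vz|nvz] := pselect (vertices F V0 (Theta r k) z).
    by rewrite ga// hz ?subrr ?normr0 ?invr_ge0//; left.
  have [w Tw [z0 _ wz]] := theta_cover hX hharm k z.
  have <- : a (Fw w b0) = e.
    apply: hz; right; split=> //; exists w => //; split; first by exists z0.
    by exists b0.
  rewrite -ga; last by exists w => //; exists b0.
  by rewrite -wz; exact: osc.
have small z : exists v, [/\ range (Fw v) z, rw v <= expR (- (k + m)%:R),
    d ^+ 2 * expR (- (k + m)%:R) <= rw v &
    forall z', range (Fw v) z' -> `|eps * g z' - eps * g z| <= 2^-1].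
  have [w Tw [z1 _ wz]] := theta_cover hX hharm k z.
  have [w' Tw' [z2 _ wz']] := theta_cover hX hharm m z1.
  have ekm : expR (- (k + m)%:R) = expR (- k%:R) * expR (- m%:R) :> R.
    by rewrite -expRD natrD opprD.
  exists (w ++ w'); split.
  - by exists z2 => //; rewrite Fword_cat wz' wz.
  - rewrite rword_cat ekm ler_pM ?(ltW (rword_gt0 hharm _))//; exact: theta_le.
  - rewrite rword_cat ekm expr2 mulrACA.
    have d0 : 0 <= d by case/andP: d01 => /ltW.
    by apply: ler_pM; rewrite ?mulr_ge0 ?expR_ge0//; exact: (theta_ge dr d01).
  - by move=> _ [z' _ <-]; rewrite Fword_cat -wz; exact: osc.
have [v [vy vle vge vosc]] := small y; have [w [wx wle wge wosc]] := small x.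
have gy := value y 0 ay; have gx := value x D ax.
have vup z : range (Fw v) z -> eps * g z <= 1.
  move=> /vosc; move: gy; rewrite mulr0 subr0 !ler_norml.
  by move=> /andP[? ?] /andP[? ?]; lra.
have wlo z : range (Fw w) z -> eps * D - 1 <= eps * g z.
  move=> /wosc; move: gx; rewrite !ler_norml.
  by move=> /andP[? ?] /andP[? ?]; lra.
apply: (heat_kernel_le hQ).
have := partial_kernel_cells hX hpcf hharm hmu K0 hK hphi t0 hQ dg hL vy wx vup wlo vle wle.
apply: filterS => N /le_trans; apply; rewrite lerD2l.
have -> : 1 - (eps * D - 1) = 2 - eps * D by ring.
rewrite ler_pM2l ?expR_gt0//.
have d2 : 0 < d ^+ 2 * expR (- (k + m)%:R).
  by rewrite mulr_gt0 ?expR_gt0// exprn_gt0//; case/andP: d01.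
have power o : d ^+ 2 * expR (- (k + m)%:R) <= rw o ->
    rw o `^ (- S) <= (d ^+ 2 * expR (- (k + m)%:R)) `^ (- S).
  move=> oge; rewrite !powRN lef_pV2 ?posrE ?powR_gt0 ?(rword_gt0 hharm)//.
  by apply: ge0_ler_powR; rewrite ?nnegrE ?(ltW S0) ?(ltW d2) ?(ltW (rword_gt0 hharm _)).
rewrite [leRHS]mulrDl mul1r; apply: lerD; last exact: power.
by rewrite ler_wpM2l ?power// mulr_ge0// expR_ge0.
Qed.

End Basis.
End Estimate.

(** The error of averaging over cells of level [k + m] has the factor
[expR (- (k + m))] under the square root. Of this, the part of level [k] restores
the power [expR (S * tau)] of the time, and the part of level [m] is left as the
decay [expR (- u)]. *)
Lemma sqrt_term_le (R : realType) (K C1 S tau k m l u : R) :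
  0 <= K -> 0 <= C1 -> tau - l <= k -> u <= m / 2 ->
  Num.sqrt (K * expR (- (k + m)) * (expR ((S + 1) * tau) * (C1 * expR (S * tau)))) <=
  Num.sqrt (K * C1) * expR (l / 2) * expR (S * tau - u).
Proof.
move=> K0 C0 kl um.
have KC : 0 <= K * C1 by rewrite mulr_ge0.
have -> : K * expR (- (k + m)) * (expR ((S + 1) * tau) * (C1 * expR (S * tau))) =
    K * C1 * expR (- (k + m) + (S + 1) * tau + S * tau).
  by rewrite !expRD; ring.
rewrite sqrtrM// -mulrA ler_wpM2l ?sqrtr_ge0// -expRD.
set z := - (k + m) + _ + _.
have -> : expR z = expR (z / 2) ^+ 2 by rewrite expr2 -expRD; congr expR; field.
rewrite sqrtr_sqr ger0_norm ?expR_ge0// ler_expR /z; lra.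
Qed.

Lemma klevel_bounds (R : realType) (S C lam : R) : (0 < klevel S C lam)%N ->
  (klevel S C lam)%:R <= (S + 1)^-1 * ln lam - ln C - 2 < (klevel S C lam)%:R + 1.
Proof.
rewrite /klevel; set f := _ - 2; set n := Num.floor f => k0.
have n0 : (0 < n)%R.
  by rewrite ltNge; apply: contraTN k0 => n0; rewrite (max_idPl _).
have -> : (absz (Num.max 0%R n))%:R = n%:~R :> R.
  by rewrite (max_idPr (ltW n0)) -[n in RHS]gez0_abs// ltW.
by have := floor_itv f; rewrite intrD.
Qed.

(** With a single map the space has one code, hence one point. Its functions
form a line, which has no infinite orthonormal family. *)
Lemma no_dirichlet_basis_single (R : realType) (X : pmetricType R) (J : nat)
  (F : 'I_J -> X -> X) (pi : shift_space J -> X)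
  (c : X -> X -> R) (r : 'I_J -> R) (S : R) (mu : probability (borel X) R)
  (phi : nat -> X -> R) (lam : nat -> R) :
  self_similar_set F pi -> \sum_(j < J) r j `^ S = 1 -> ~~ (1 < J)%N ->
  ~ dirichlet_eigenbasis F (V0 F pi) c r mu phi lam.
Proof.
move=> hX hS J1 [[_ orth _] _ _].
have pt (x y : X) : x = y.
  have [om <-] := ss_pi_surj hX x; have [ka <-] := ss_pi_surj hX y.
  congr pi; apply/funext => n; move: (om n) (ka n); rewrite -leqNgt in J1.
  by case: J J1 {F pi r hX hS om ka} => [_ []//|[_|//]] i j; rewrite !ord1.
have cst i j : \int[mu]_x (phi i x * phi j x) = phi i point * phi j point.
  rewrite -[RHS](Rint_cst mu); apply: eq_Rintegral => x _.
  by rewrite (pt x point).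
have h0 := orth 0%N 0%N; have h1 := orth 1%N 1%N; have h01 := orth 0%N 1%N.
rewrite !cst /= in h0 h1 h01.
have : (phi 0%N point * phi 0%N point) * (phi 1%N point * phi 1%N point) = 0.
  by rewrite mulrACA h01 mul0r.
by rewrite h0 h1 mulr1 => /eqP; rewrite oner_eq0.
Qed.

Theorem theorem10p2 (R : realType) (X : pmetricType R) (J : nat)
  (F : 'I_J -> X -> X) (pi : shift_space J -> X)
  (c : X -> X -> R) (r : 'I_J -> R) (S : R) (mu : probability (borel X) R)
  (C : R)
  (hX : self_similar_set F pi)
  (hpcf : post_critically_finite F pi)
  (hconn : connected (~` V0 F pi))
  (hharm : regular_harmonic_structure F (V0 F pi) c r)
  (hS : \sum_(j < J) r j `^ S = 1)
  (hmu : self_similar_measure F r S mu)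
  (hC0 : 0 < C)
  (hC : admissible_constant F (V0 F pi) c r mu S C) :
  exists kappa7 : R, 0 < kappa7 /\
  exists c' : R, 0 < c' /\
  forall (phi : nat -> X -> R) (lam : nat -> R),
    dirichlet_eigenbasis F (V0 F pi) c r mu phi lam ->
  forall (t : R) (x y : X), 0 < t ->
    `|heat_kernel phi lam t x y| <=
    c' * (t `^ (- (S / (S + 1))) *
      expR (- kappa7 * cell_dist F (V0 F pi) r (klevel S C t^-1) x y)).
Proof.
have [J1|J1] := boolP (1 < J)%N; last first.
  exists 1; split=> //; exists 1; split=> // phi lam hphi.
  by case: (no_dirichlet_basis_single hX hS J1 hphi).
have S0 := dimension_gt0 hharm J1 hS.
have s0 : 0 < S + 1 by rewrite addr_gt0.
have [K K0 hK] := oscillation hX hpcf hconn hharm J1.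
have [d d01 dr] := ratio_lower hharm.
have d0 : 0 < d by case/andP: d01.
pose Mg := total_conductance F pi c.
have Mg0 : 0 <= Mg := total_conductance_ge0 hpcf hharm.
pose C1 := K + 2 * K * expR 1 + 2 * d `^ (- S).
have C10 : 0 < C1.
  by rewrite !addr_gt0 ?mulr_gt0 ?expR_gt0 ?powR_gt0.
(* [Mg] bounds the energy, on a cell, of a spline with increments at most one,
   and the weighted energy inequality needs [6 * eps ^+ 2 * K * Mg <= 1]. *)
pose eps := (1 + 6 * K * Mg)^-1.
have A0 : 0 <= 6 * K * Mg by rewrite mulr_ge0// mulr_ge0// ltW.
have eps0 : 0 < eps by rewrite invr_gt0 ltr_pwDl.
have eps1 : eps <= 1 by rewrite invf_le1 ?lerDl// ltr_pwDl.
have epsM : 6 * eps ^+ 2 * K * Mg <= 1.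
  have -> : 6 * eps ^+ 2 * K * Mg = eps * (eps * (6 * K * Mg)) by ring.
  apply: mulr_ile1 => //; [exact: ltW|exact: mulr_ge0 (ltW eps0) A0|].
  by rewrite /eps mulrC ler_pdivrMr ?mul1r ?lerDr// ltr_pwDl.
(* Averaging over cells of level [k + m] costs a factor [expR (S * m)] in the
   measure and gains [expR (- m / 2)] in the oscillation; with [m] close to
   [eps * D / (S + 1)] the weight [expR (- eps * D)] pays for the cost, and half of
   [m] remains as the decay. *)
pose kappa := eps / (2 * (S + 1)).
have kappa0 : 0 < kappa by rewrite divr_gt0// mulr_gt0.
pose b0 := d `^ (- (S + 1)) * expR (- ((S + 1) * (ln C + 2))).
pose c2 := 2 * (Num.sqrt (K * C1) * expR ((ln C + 3) / 2) * expR (2^-1)).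
pose c3 := (2 * expR (2 * K^-1 * b0) + 1) * (d ^+ 2) `^ (- S) *
  expR (2 - S * (ln C + 2)).
have c20 : 0 <= c2 by rewrite !mulr_ge0 ?expR_ge0 ?sqrtr_ge0.
have c30 : 0 <= c3.
  by rewrite !mulr_ge0 ?expR_ge0 ?powR_ge0// addr_ge0// mulr_ge0// expR_ge0.
exists kappa; split=> //; exists (C1 * expR kappa + c2 + c3); split.
  by rewrite -addrA ltr_pwDl ?addr_ge0// mulr_gt0// expR_gt0.
move=> phi lam hphi t x y t0.
set k := klevel S C t^-1; set D := cell_dist _ _ _ k x y.
have D0 : 0 <= D := cell_dist_ge0 _ _ _ _ _ _.
(* The cells of level [tau] have the size that corresponds to the time [t]; a
   positive [k] differs from [tau] by a constant only. *)
pose tau := - ln t / (S + 1).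
have tE : t = expR (- ((S + 1) * tau)).
  rewrite /tau mulrCA divff ?gt_eqF// mulr1 opprK lnK//.
have tS : t `^ (- (S / (S + 1))) = expR (S * tau).
  rewrite /powR gt_eqF//; congr expR; rewrite /tau; field; exact: lt0r_neq0.
have hQ N z : partial_kernel phi lam N t z z <= C1 * expR (S * tau).
  by rewrite tE; exact: (diagonal_bound hX hpcf hconn hharm J1 hS hmu K0 hK d01 dr hphi).
rewrite tS -expRD.
have [k0|kpos] := posnP k.
  have diag : `|heat_kernel phi lam t x y| <= C1 * expR (S * tau).
    exact: heat_kernel_diagonal.
  apply: le_trans diag _.
  have D1 : D <= 1 by rewrite /D k0; exact: (cell_dist_level0 hX hpcf hconn hharm J1).
  apply: (@le_trans _ _ (C1 * expR kappa * expR (S * tau + - kappa * D))).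
    rewrite -mulrA -expRD ler_pM2l// ler_expR mulNr.
    by have := ler_pM2l kappa0 D 1; rewrite D1 mulr1 => h; lra.
  by rewrite ler_wpM2r ?expR_ge0// -addrA lerDl addr_ge0.
have /andP[kle kge] := klevel_bounds kpos.
rewrite -/k lnV ?posrE// in kle kge.
have tauE : (S + 1)^-1 * - ln t = tau by rewrite /tau mulrC.
rewrite tauE in kle kge.
pose m := Num.truncn (eps * D / (S + 1)).
have eD0 : 0 <= eps * D / (S + 1).
  by apply: divr_ge0; [exact: mulr_ge0 (ltW eps0) D0|exact: ltW].
have /andP[m1 m2] := truncn_itv eD0; rewrite -/m -natr1 in m1 m2.
have main := off_diagonal hX hpcf hconn hharm J1 hS hmu K0 hK d01 dr hphi epsM k m x y t0 hQ.
apply: le_trans main _; rewrite -/D.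
have kD : kappa * D = eps * D / (S + 1) / 2.
  by rewrite /kappa; field; exact: lt0r_neq0.
have first : 2 * Num.sqrt (K * expR (- (k + m)%:R) * (t^-1 * (C1 * expR (S * tau)))) <=
    c2 * expR (S * tau + - kappa * D).
  rewrite /c2 -[leRHS]mulrA ler_pM2l//.
  have -> : t^-1 = expR ((S + 1) * tau) by rewrite [in LHS]tE -expRN opprK.
  rewrite natrD.
  have := @sqrt_term_le R K C1 S tau k%:R m%:R (ln C + 3) (kappa * D - 2^-1) (ltW K0) (ltW C10).
  have h1 : tau - (ln C + 3) <= k%:R by lra.
  have h2 : kappa * D - 2^-1 <= m%:R / 2 by rewrite kD; lra.
  move=> /(_ h1 h2) h; apply: le_trans h _.
  rewrite mulNr; set q := kappa * D.
  rewrite -!mulrA -!expRD le_eqVlt; apply/orP; left; apply/eqP.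
  by congr (_ * expR _); ring.
have scale : 2 * (K^-1 * (d * expR (- k%:R)) `^ (- (S + 1))) * t <= 2 * K^-1 * b0.
  rewrite -!mulrA ler_pM2l// ler_pM2l ?invr_gt0// powRM ?expR_ge0 ?(ltW d0)//.
  rewrite powR_expR -mulrA ler_pM2l ?powR_gt0// [in leLHS]tE -expRD ler_expR.
  by have := ler_wpM2l (ltW s0) kle; lra.
have second : expR (2 - eps * D) *
    ((2 * expR (2 * (K^-1 * (d * expR (- k%:R)) `^ (- (S + 1))) * t) + 1) *
     (d ^+ 2 * expR (- (k + m)%:R)) `^ (- S)) <= c3 * expR (S * tau + - kappa * D).
  rewrite [(d ^+ 2 * _) `^ _]powRM ?expR_ge0 ?sqr_ge0// powR_expR.
  set P := (d ^+ 2) `^ (- S).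
  have P0 : 0 <= P by exact: powR_ge0.
  set z := 2 * _ * t in scale *.
  have -> : expR (2 - eps * D) * ((2 * expR z + 1) * (P * expR (- S * - (k + m)%:R))) =
      (2 * expR z + 1) * (P * (expR (2 - eps * D) * expR (- S * - (k + m)%:R))) by ring.
  rewrite /c3 -/P -!mulrA -!expRD.
  apply: ler_pM; rewrite ?addr_ge0 ?mulr_ge0 ?expR_ge0//.
    by rewrite lerD2r ler_pM2l// ler_expR mulrA.
  rewrite ler_wpM2l// ler_expR natrD mulrNN.
  have h1 := ler_wpM2l (ltW S0) kle.
  have h2 : S * m%:R <= eps * D - eps * D / (S + 1).
    have -> : eps * D - eps * D / (S + 1) = S * (eps * D / (S + 1)).
      by field; exact: lt0r_neq0.
    by rewrite ler_pM2l.
  by rewrite mulNr kD; lra.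
apply: le_trans (lerD first second) _; rewrite -mulrDl ler_wpM2r ?expR_ge0//.
by rewrite -addrA lerDr mulr_ge0 ?expR_ge0// ltW.
Qed.
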